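(* Suppose $V$ is a retract of $U$ in the category $\mathbb E$, i.e. there are an interpretation $K$ of $V$ in $U$ and an interpretation $M$ of $U$ in $V$ such that for every $V$-sentence $B$, $V\vdash (B^K)^M\leftrightarrow B$. If $U$ is (effectively) Friedman-reflexive, then $V$ is (effectively) Friedman-reflexive.
   Context: Theories are first-order theories in finite signature with arbitrary axiom sets; interpretations may be multi-dimensional and piecewise; $W\rhd D$ means $W$ interprets $D$; $B^K$ is the translation of $B$ under $K$. $\mathbb E$ is the category of theories and interpretations where two interpretations $K,K'$ of $T$ in $W$ are identified iff $W\vdash A^K\leftrightarrow A^{K'}$ for all $T$-sentences $A$. A $U$-sentence $C$ is an interpreter of finitely axiomatised $A$ over $U$ iff for all $U$-sentences $B$: $(U+B)\rhd A$ iff $U+B\vdash C$; $U$ is Friedman-reflexive iff every finitely axiomatised $A$ has one, effectively so if they can be chosen recursively. *)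

(* Defs.v *)
From mathcomp Require Import all_boot.
From Stdlib Require List Cantor.

Set Implicit Arguments.
Unset Strict Implicit.
Unset Printing Implicit Defensive.

(* Function and relation symbols are numbered; a signature lists their arities
   (constants are 0-ary function symbols).  Identity is logical. *)
Record signature := Signature { farities : seq nat; rarities : seq nat }.

Definition fsym (S : signature) := 'I_(size (farities S)).
Definition rsym (S : signature) := 'I_(size (rarities S)).
Definition far (S : signature) (f : fsym S) : nat := nth 0 (farities S) f.
Definition rar (S : signature) (r : rsym S) : nat := nth 0 (rarities S) r.

(* Variables are de Bruijn indices. *)
Inductive term (S : signature) :=
  | Var (x : nat)
  | Fun (f : fsym S) (ts : {ffun 'I_(far f) -> term S}).
Arguments Var {S} x.
Arguments Fun {S} f ts.

Inductive fm (At : Type) :=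
  | Bot
  | Atom (a : At)
  | Imp (A B : fm At)
  | All (A : fm At).
Arguments Bot {At}.
Arguments Atom {At} a.
Arguments Imp {At} A B.
Arguments All {At} A.

Section Connectives.
Variable At : Type.
Implicit Types A B : fm At.

Definition Neg A := Imp A Bot.
Definition And A B := Neg (Imp A (Neg B)).
Definition Iff A B := And (Imp A B) (Imp B A).
Definition Ex A := Neg (All (Neg A)).
Definition Conj (As : seq (fm At)) : fm At := foldr And (Imp Bot Bot) As.
Definition Alls (n : nat) A := iter n (@All At) A.
Definition Exs (n : nat) A := iter n Ex A.

End Connectives.

Inductive atom (S : signature) :=
  | AEq (s t : term S)
  | ARel (r : rsym S) (ts : {ffun 'I_(rar r) -> term S}).
Arguments AEq {S} s t.
Arguments ARel {S} r ts.

Definition form (S : signature) := fm (atom S).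

Section Substitution.
Variable S : signature.

Fixpoint subst_term (sigma : nat -> term S) (t : term S) : term S :=
  match t with
  | Var x => sigma x
  | Fun f ts => Fun f [ffun k => subst_term sigma (ts k)]
  end.

Definition up (sigma : nat -> term S) (x : nat) : term S :=
  if x is y.+1 then subst_term (fun z => Var z.+1) (sigma y) else Var 0.

Definition subst_atom (sigma : nat -> term S) (a : atom S) : atom S :=
  match a with
  | AEq s t => AEq (subst_term sigma s) (subst_term sigma t)
  | ARel r ts => ARel r [ffun k => subst_term sigma (ts k)]
  end.

Fixpoint subst (sigma : nat -> term S) (A : form S) : form S :=
  match A with
  | Bot => Bot
  | Atom a => Atom (subst_atom sigma a)
  | Imp A B => Imp (subst sigma A) (subst sigma B)
  | All A => All (subst (up sigma) A)
  end.

Definition shift (A : form S) : form S := subst (fun x => Var x.+1) A.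

(* A with variable 0 replaced by t (and the other variables lowered). *)
Definition subst0 (A : form S) (t : term S) : form S :=
  subst (fun x => if x is y.+1 then Var y else t) A.

(* All free variables are < n. *)
Fixpoint bounded_term (n : nat) (t : term S) : bool :=
  match t with
  | Var x => x < n
  | Fun f ts => [forall k, bounded_term n (ts k)]
  end.

Definition bounded_atom (n : nat) (a : atom S) : bool :=
  match a with
  | AEq s t => bounded_term n s && bounded_term n t
  | ARel r ts => [forall k, bounded_term n (ts k)]
  end.

Fixpoint bounded (n : nat) (A : form S) : bool :=
  match A with
  | Bot => true
  | Atom a => bounded_atom n a
  | Imp A B => bounded n A && bounded n B
  | All A => bounded n.+1 A
  end.

End Substitution.

Definition sentence (S : signature) := {A : form S | bounded 0 A}.

(* Classical natural deduction with identity.  The set of assumptions may be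
   infinite. *)
Inductive prv (S : signature) (Gamma : form S -> Prop) : form S -> Prop :=
  | prv_ax A : Gamma A -> prv Gamma A
  | prv_impI A B : prv (fun C => Gamma C \/ C = A) B -> prv Gamma (Imp A B)
  | prv_impE A B : prv Gamma (Imp A B) -> prv Gamma A -> prv Gamma B
  | prv_contra A : prv (fun C => Gamma C \/ C = Neg A) Bot -> prv Gamma A
  | prv_allI A :
      prv (fun C => exists2 B, Gamma B & C = shift B) A -> prv Gamma (All A)
  | prv_allE A t : prv Gamma (All A) -> prv Gamma (subst0 A t)
  | prv_refl t : prv Gamma (Atom (AEq t t))
  | prv_leibniz A s t :
      prv Gamma (Atom (AEq s t)) -> prv Gamma (subst0 A s) ->
      prv Gamma (subst0 A t).

Record theory := Theory { sig : signature; axioms : sentence sig -> Prop }.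

Definition proves (T : theory) (A : form (sig T)) : Prop :=
  prv (fun B => exists2 C : sentence (sig T), axioms C & B = sval C) A.

Definition add_axiom (U : theory) (B : sentence (sig U)) : theory :=
  @Theory (sig U) (fun C => axioms C \/ C = B).

Record fin_theory :=
  FinTheory { fin_sig : signature; fin_axioms : seq (sentence fin_sig) }.

Definition theory_of_fin (A : fin_theory) : theory :=
  @Theory (fin_sig A) (fun C => List.In C (fin_axioms A)).
Coercion theory_of_fin : fin_theory >-> theory.

(* Atoms of the relational language in which an n-ary function symbol f is
   replaced by its (n+1)-ary graph: FFun f xs y says f(xs) = y. *)
Inductive flat_atom (S : signature) :=
  | FEq (x y : nat)
  | FRel (r : rsym S) (xs : {ffun 'I_(rar r) -> nat})
  | FFun (f : fsym S) (xs : {ffun 'I_(far f) -> nat}) (y : nat).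
Arguments FEq {S} x y.
Arguments FRel {S} r xs.
Arguments FFun {S} f xs y.

Section Unwinding.
Variable S : signature.

Definition is_var (t : term S) : bool := if t is Var _ then true else false.
Definition var_index (t : term S) : nat := if t is Var x then x else 0.

(* [unwind_term d t y] says that the variable y is the value of t, where the
   variables of t are first raised by d. *)
Fixpoint unwind_term (d : nat) (t : term S) (y : nat) : fm (flat_atom S) :=
  match t with
  | Var x => Atom (FEq (d + x) y)
  | Fun f ts =>
      if [forall k, is_var (ts k)]
      then Atom (FFun f [ffun k => d + var_index (ts k)] y)
      else Exs (far f)
             (And (Conj [seq unwind_term (far f + d) (ts k) k
                        | k <- enum 'I_(far f)])
                  (Atom (FFun f [ffun k => val k] (far f + y))))
  end.

Definition unwind_atom (a : atom S) : fm (flat_atom S) :=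
  match a with
  | AEq s (Var y) => unwind_term 0 s y
  | AEq s t => Ex (And (unwind_term 1 t 0) (unwind_term 1 s 0))
  | ARel r ts =>
      if [forall k, is_var (ts k)]
      then Atom (FRel r [ffun k => var_index (ts k)])
      else Exs (rar r)
             (And (Conj [seq unwind_term (rar r) (ts k) k
                        | k <- enum 'I_(rar r)])
                  (Atom (FRel r [ffun k => val k])))
  end.

Fixpoint unwind (A : form S) : fm (flat_atom S) :=
  match A with
  | Bot => Bot
  | Atom a => unwind_atom a
  | Imp A B => Imp (unwind A) (unwind B)
  | All A => All (unwind A)
  end.

End Unwinding.

(* The piece i is a class of (tr_dim i)-tuples, cut out by tr_dom i.  The
   formulas tr_eq, tr_rel, tr_fun interpret identity, the relation symbols and
   the graphs of the function symbols for every choice of pieces for their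
   arguments; the free variables 0, 1, 2, ... of these formulas are the
   coordinates of the first argument, followed by those of the second, etc.
   (for tr_fun, the value comes last).  Pieces may have different dimensions
   and need not be disjoint as classes of tuples; identity between elements of
   possibly different pieces is given by tr_eq.  Dimension 0
   is allowed.  There are no parameters. *)
Record translation (S T : signature) := Translation {
  tr_pred_pieces : nat; (* the number of pieces minus 1 *)
  piece := 'I_tr_pred_pieces.+1;
  tr_dim : piece -> nat;
  tr_dom : piece -> form T;
  tr_eq : piece -> piece -> form T;
  tr_rel : forall r : rsym S, {ffun 'I_(rar r) -> piece} -> form T;
  tr_fun : forall f : fsym S, {ffun 'I_(far f) -> piece} -> piece -> form T;
  tr_dom_bounded : forall i, bounded (tr_dim i) (tr_dom i);
  tr_eq_bounded : forall i j, bounded (tr_dim i + tr_dim j) (tr_eq i j);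
  tr_rel_bounded : forall r (p : {ffun 'I_(rar r) -> piece}),
    bounded (\sum_k tr_dim (p k)) (tr_rel p);
  tr_fun_bounded : forall f (p : {ffun 'I_(far f) -> piece}) (i : piece),
    bounded (\sum_k tr_dim (p k) + tr_dim i) (tr_fun p i)
}.

Section Translate.
Variables (S T : signature) (K : translation S T).
Notation piece := (piece K).

Definition inst (A : form T) (xs : seq nat) : form T :=
  subst (fun x => Var (nth 0 xs x)) A.

(* An environment e gives the pieces over which the bound source variables
   range, innermost binder first.  The source variable x is rendered by the
   consecutive target variables [block e x]. *)
Definition piece_of (e : seq piece) (x : nat) : piece := nth ord0 e x.

Definition block (e : seq piece) (x : nat) : seq nat :=
  iota (sumn [seq tr_dim i | i <- take x e]) (tr_dim (piece_of e x)).

Definition translate_atom (e : seq piece) (a : flat_atom S) : form T :=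
  match a with
  | FEq x y =>
      inst (tr_eq (piece_of e x) (piece_of e y)) (block e x ++ block e y)
  | FRel r xs =>
      inst (tr_rel [ffun k => piece_of e (xs k)])
           (flatten [seq block e (xs k) | k <- enum 'I_(rar r)])
  | FFun f xs y =>
      inst (tr_fun [ffun k => piece_of e (xs k)] (piece_of e y))
           (flatten [seq block e (xs k) | k <- enum 'I_(far f)] ++ block e y)
  end.

Fixpoint translate_flat (e : seq piece) (A : fm (flat_atom S)) : form T :=
  match A with
  | Bot => Bot
  | Atom a => translate_atom e a
  | Imp A B => Imp (translate_flat e A) (translate_flat e B)
  | All A =>
      Conj [seq Alls (tr_dim i) (Imp (tr_dom i) (translate_flat (i :: e) A))
           | i <- enum 'I_(tr_pred_pieces K).+1]
  end.

Definition translate (A : form S) : form T := translate_flat [::] (unwind A).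

End Translate.

(* Quantifying over the theorems of T rather than over its axioms also covers
   the axioms of identity, the nonemptiness of the domain, and the totality and
   functionality of the function symbols. *)
Record interpretation (T W : theory) := Interpretation {
  itr :> translation (sig T) (sig W);
  itr_sound : forall A : sentence (sig T),
    proves (sval A) -> proves (T := W) (translate itr (sval A))
}.

Definition interprets (W D : theory) : Prop := inhabited (interpretation D W).

(* V is a retract of U in the category of theories and interpretations modulo
   provable equivalence of the translations of sentences. *)
Definition retract (V U : theory) : Prop :=
  exists (K : interpretation V U) (M : interpretation U V),
    forall B : sentence (sig V),
      proves (T := V) (Iff (translate M (translate K (sval B))) (sval B)).

Inductive recursive : forall n, (n.-tuple nat -> nat) -> Prop :=
  | rec_zero : @recursive 0 (fun=> 0)
  | rec_succ : @recursive 1 (fun x => (thead x).+1)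
  | rec_proj n (i : 'I_n) : @recursive n (fun x => tnth x i)
  | rec_comp m n (f : m.-tuple nat -> nat) (g : 'I_m -> n.-tuple nat -> nat) :
      recursive f -> (forall i, recursive (g i)) ->
      recursive (fun x => f [tuple g i x | i < m])
  | rec_prim n (f : n.-tuple nat -> nat) (g : n.+2.-tuple nat -> nat)
      (h : n.+1.-tuple nat -> nat) :
      recursive f -> recursive g ->
      (forall x : n.-tuple nat, h [tuple of 0 :: x] = f x) ->
      (forall k (x : n.-tuple nat), h [tuple of k.+1 :: x] =
                   g [tuple of k :: h [tuple of k :: x] :: x]) ->
      recursive h
  | rec_min n (f : n.+1.-tuple nat -> nat) (g : n.-tuple nat -> nat) :
      recursive f ->
      (forall x : n.-tuple nat, f [tuple of g x :: x] = 0) ->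
      (forall (x : n.-tuple nat) k, k < g x -> f [tuple of k :: x] <> 0) ->
      recursive g
  | rec_ext n (f g : n.-tuple nat -> nat) :
      f =1 g -> recursive f -> recursive g.

Definition recursive1 (f : nat -> nat) : Prop :=
  @recursive 1 (fun x => f (thead x)).

Definition pair_code (x y : nat) : nat := Cantor.to_nat (x, y).

Fixpoint seq_code (s : seq nat) : nat :=
  if s is x :: s' then (pair_code x (seq_code s')).+1 else 0.

Fixpoint term_code (S : signature) (t : term S) : nat :=
  match t with
  | Var x => pair_code 0 x
  | Fun f ts =>
      pair_code 1 (pair_code f
        (seq_code [seq term_code (ts k) | k <- enum 'I_(far f)]))
  end.

Definition atom_code (S : signature) (a : atom S) : nat :=
  match a with
  | AEq s t => pair_code 0 (pair_code (term_code s) (term_code t))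
  | ARel r ts =>
      pair_code 1 (pair_code r
        (seq_code [seq term_code (ts k) | k <- enum 'I_(rar r)]))
  end.

Fixpoint form_code (S : signature) (A : form S) : nat :=
  match A with
  | Bot => pair_code 0 0
  | Atom a => pair_code 1 (atom_code a)
  | Imp A B => pair_code 2 (pair_code (form_code A) (form_code B))
  | All A => pair_code 3 (form_code A)
  end.

Definition sentence_code (S : signature) (A : sentence S) : nat :=
  form_code (sval A).

Definition signature_code (S : signature) : nat :=
  pair_code (seq_code (farities S)) (seq_code (rarities S)).

Definition fin_theory_code (A : fin_theory) : nat :=
  pair_code (signature_code (fin_sig A))
            (seq_code [seq sentence_code B | B <- fin_axioms A]).

Definition is_interpreter (U : theory) (A : fin_theory) (C : sentence (sig U))
    : Prop :=
  forall B : sentence (sig U),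
    interprets (add_axiom B) A <-> proves (T := add_axiom B) (sval C).

Definition friedman_reflexive (U : theory) : Prop :=
  forall A : fin_theory, exists C : sentence (sig U), is_interpreter A C.

Definition effectively_friedman_reflexive (U : theory) : Prop :=
  exists2 f : nat -> nat, recursive1 f &
    forall A : fin_theory, exists2 C : sentence (sig U),
      is_interpreter A C & f (fin_theory_code A) = sentence_code C.

(* Main.v *)
(* If C is an interpreter of A over U, then its translation C^M is one over V.
   If V+B |- C^M, then V+B interprets U+C via M, and U+C interprets A.
   Conversely, if V+B interprets A, then so does U+B^K, hence U+B^K |- C and
   V+(B^K)^M |- C^M, where (B^K)^M is equivalent to B over V.  As M is a fixed
   translation, C |-> C^M is recursive on codes.

   Interpretations compose because the translation under the composition of K
   and M is equivalent to the iterated translation.  This is verified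
   semantically: M turns a model into a relational structure, K turns that one
   into a further structure, and the latter is bisimilar to the one obtained
   directly from the composition.  A Henkin argument converts the semantic
   equivalence into provability; since the equivalence holds for arbitrary
   readings of identity and of the function graphs, it suffices to use Henkin
   sets of formulas, without passing to a quotient. *)

From mathcomp Require Import all_boot zify.
From Stdlib Require Import Classical ClassicalEpsilon FunctionalExtensionality
  PropExtensionality.
From Stdlib Require List Cantor.
Require Import Defs.

Set Implicit Arguments.
Unset Strict Implicit.
Unset Printing Implicit Defensive.

(** * Substitution and deduction *)

(** A syntactic comparison of the composed with the iterated translation would have to follow
    variables through two renumberings into blocks and through a second unwinding, because the
    formulas by which [K] renders the symbols may themselves contain function terms. Semantically
    the second unwinding is harmless: a flat structure, read through [unwind], is again a
    [satisfaction], so one lemma about induced structures applies once for [M] and once more for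
    [K]. As [itr_sound] speaks of all theorems, this comparison is the only place where completeness
    is called for; added axioms are handled by the deduction theorem.

    Effectivity meets another obstacle. Recursive functions act on tuples of numbers, whereas
    [translate] recurses over formulas with a growing environment and branches on symbols of various
    arities. Hence the notion of computability for functions between coded types, with its own
    recursion principle. The pieces and defining formulas of the translation are finite data and
    enter by case distinction. *)

Section Substitutions.
Variable S : signature.
Implicit Types (t : term S) (A B : form S) (s : nat -> term S) (n : nat).

(** The arguments of a function symbol are nested inside a finite function; the explicit fixpoint
    provides induction hypotheses for them, each [ts k] being a subterm. *)
Lemma term_ffun_ind (P : term S -> Prop) :
  (forall x, P (Var x)) ->
  (forall f (ts : {ffun 'I_(far f) -> term S}),
    (forall k, P (ts k)) -> P (Fun f ts)) ->
  forall t, P t.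
Proof.
move=> PV PF; fix IH 1 => - [x|f ts]; first exact: PV.
by apply: PF => k; apply: IH.
Qed.

Lemma subst_term_comp s1 s2 t :
  subst_term s1 (subst_term s2 t) = subst_term (fun x => subst_term s1 (s2 x)) t.
Proof.
elim/term_ffun_ind: t => //= f ts IH.
by congr Fun; apply/ffunP => k; rewrite !ffunE.
Qed.

Lemma subst_term_eq_bounded n s1 s2 t :
  bounded_term n t -> (forall x, x < n -> s1 x = s2 x) ->
  subst_term s1 t = subst_term s2 t.
Proof.
move=> bt eq_s; elim/term_ffun_ind: t bt => [x|f ts IH] /=; first exact: eq_s.
by move/forallP=> bts; congr Fun; apply/ffunP => k; rewrite !ffunE IH.
Qed.

Lemma subst_term_id t : subst_term Var t = t.
Proof.
elim/term_ffun_ind: t => //= f ts IH.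
by congr Fun; apply/ffunP => k; rewrite ffunE.
Qed.

Lemma up_comp s1 s2 :
  (fun x => subst_term (up s1) (up s2 x)) = up (fun x => subst_term s1 (s2 x)).
Proof.
by apply: functional_extensionality => - [|x] //=; rewrite !subst_term_comp.
Qed.

Lemma subst_comp s1 s2 A :
  subst s1 (subst s2 A) = subst (fun x => subst_term s1 (s2 x)) A.
Proof.
elim: A s1 s2 => [|[t1 t2|r ts]|A IHA B IHB|A IH] s1 s2 //=.
- by rewrite !subst_term_comp.
- by congr (Atom (ARel _ _)); apply/ffunP => k; rewrite !ffunE subst_term_comp.
- by rewrite IHA IHB.
- by rewrite IH up_comp.
Qed.

Lemma subst_eq_bounded n s1 s2 A :
  bounded n A -> (forall x, x < n -> s1 x = s2 x) -> subst s1 A = subst s2 A.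
Proof.
elim: A n s1 s2 => [|[t1 t2|r ts]|A IHA B IHB|A IH] n s1 s2 //= bA eq_s.
- case/andP: bA => b1 b2.
  by rewrite (subst_term_eq_bounded b1 eq_s) (subst_term_eq_bounded b2 eq_s).
- congr (Atom (ARel _ _)); apply/ffunP => k; rewrite !ffunE.
  by move/forallP/(_ k)/subst_term_eq_bounded: bA; apply.
- by case/andP: bA => bA bB; rewrite (IHA n _ s2) // (IHB n _ s2).
- by congr All; apply: IH bA _ => - [|x] //=; rewrite ltnS => /eq_s ->.
Qed.

Lemma subst_id A : subst Var A = A.
Proof.
have upV : up (@Var S) = Var by apply: functional_extensionality => - [].
elim: A => [|[t1 t2|r ts]|A IHA B IHB|A IH] //=.
- by rewrite !subst_term_id.
- by congr (Atom (ARel _ _)); apply/ffunP => k; rewrite !ffunE subst_term_id.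
- by rewrite IHA IHB.
- by rewrite upV IH.
Qed.

Lemma bounded_term_mono m n t : m <= n -> bounded_term m t -> bounded_term n t.
Proof.
move=> le_mn; elim/term_ffun_ind: t => [x|f ts IH] /=; first by move/leq_trans; apply.
by move/forallP=> bt; apply/forallP => k; apply: IH.
Qed.

Lemma bounded_mono m n A : m <= n -> bounded m A -> bounded n A.
Proof.
elim: A m n => [|[t1 t2|r ts]|A IHA B IHB|A IH] m n //= le_mn.
- by case/andP=> /(bounded_term_mono le_mn) -> /(bounded_term_mono le_mn) ->.
- by move/forallP=> bt; apply/forallP => k; apply: bounded_term_mono (bt k).
- by case/andP=> /(IHA _ _ le_mn) -> /(IHB _ _ le_mn) ->.
- exact: IH.
Qed.

Lemma ex_bounded_term t : exists n, bounded_term n t.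
Proof.
elim/term_ffun_ind: t => [x|f ts IH] /=; first by exists x.+1.
pose b k := proj1_sig (constructive_indefinite_description _ (IH k)).
exists (\max_k b k); apply/forallP => k.
apply: bounded_term_mono (leq_bigmax k) _.
exact: proj2_sig (constructive_indefinite_description _ (IH k)).
Qed.

Lemma ex_bounded A : exists n, bounded n A.
Proof.
elim: A => [|[t1 t2|r ts]|A [m bA] B [n bB]|A [n bA]] /=.
- by exists 0.
- have [[m b1] [n b2]] := (ex_bounded_term t1, ex_bounded_term t2).
  exists (maxn m n).
  by rewrite (bounded_term_mono _ b1) ?leq_maxl // (bounded_term_mono _ b2) ?leq_maxr.
- pose b k := constructive_indefinite_description _ (ex_bounded_term (ts k)).
  exists (\max_k proj1_sig (b k)); apply/forallP => k.
  exact: bounded_term_mono (leq_bigmax k) (proj2_sig (b k)).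
- exists (maxn m n).
  by rewrite (bounded_mono _ bA) ?leq_maxl // (bounded_mono _ bB) ?leq_maxr.
- by exists n; apply: bounded_mono bA.
Qed.

End Substitutions.

Section Deduction.
Variable S : signature.
Implicit Types (A B C : form S) (G H : form S -> Prop).

(** Contexts are predicates, so besides weakening this also replaces a context by an equivalent
    description of it. *)
Lemma prv_mono G H A : (forall B, G B -> H B) -> prv G A -> prv H A.
Proof.
move=> sGH pA; elim: pA H sGH => {G A}.
- by move=> G A GA H sGH; apply/prv_ax/sGH.
- by move=> G A B _ IH H sGH; apply/prv_impI/IH => C [/sGH|]; [left|right].
- by move=> G A B _ IH1 _ IH2 H sGH; apply: prv_impE (IH1 _ sGH) (IH2 _ sGH).
- by move=> G A _ IH H sGH; apply/prv_contra/IH => C [/sGH|]; [left|right].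
- by move=> G A _ IH H sGH; apply/prv_allI/IH => C [B /sGH]; exists B.
- by move=> G A t _ IH H sGH; apply/prv_allE/IH.
- by move=> G t H _; apply: prv_refl.
- by move=> G A s t _ IH1 _ IH2 H sGH; apply: prv_leibniz (IH1 _ sGH) (IH2 _ sGH).
Qed.

Lemma subst_subst0 s A t :
  subst s (subst0 A t) = subst0 (subst (up s) A) (subst_term s t).
Proof.
rewrite /subst0 !subst_comp; congr (subst _ A); apply: functional_extensionality.
by case=> //= x; rewrite subst_term_comp subst_term_id.
Qed.

Lemma subst_up_shift s A : subst (up s) (shift A) = shift (subst s A).
Proof. by rewrite /shift !subst_comp. Qed.

Lemma prv_subst s G A :
  prv G A -> prv (fun C => exists2 B, G B & C = subst s B) (subst s A).
Proof.
move=> pA; elim: pA s => {G A}.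
- by move=> G A GA s; apply: prv_ax; exists A.
- move=> G A B _ IH s; apply: prv_impI; apply: prv_mono (IH s) => C [D].
  by case=> [GD|->] ->; [left; exists D|right].
- by move=> G A B _ IH1 _ IH2 s; apply: prv_impE (IH1 s) (IH2 s).
- move=> G A _ IH s; apply: prv_contra; apply: prv_mono (IH s) => C [D].
  by case=> [GD|->] ->; [left; exists D|right].
- move=> G A _ IH s; apply: prv_allI; apply: prv_mono (IH (up s)) => C [D].
  case=> [B GB ->] ->; exists (subst s B); first by exists B.
  exact: subst_up_shift.
- by move=> G A t _ IH s; rewrite subst_subst0; apply/prv_allE/IH.
- by move=> G t s; apply: prv_refl.
- move=> G A t1 t2 _ IH1 _ IH2 s; rewrite subst_subst0.
  by apply: prv_leibniz (IH1 s) _; rewrite -subst_subst0.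
Qed.

(** The rule [prv_allI] shifts the context; the Henkin construction generalises over a fresh
    variable instead. The renaming that sends [n] to 0 and raises the variables below [n] turns the
    instance back into [B] and each hypothesis into its shift. *)
Lemma prv_all_fresh n G B :
  (forall C, G C -> bounded n C) -> bounded n.+1 B ->
  prv G (subst0 B (Var n)) -> prv G (All B).
Proof.
move=> bG bB /(prv_subst (fun x => if x < n then Var x.+1 else Var 0)).
suff ->: subst (fun x => if x < n then Var x.+1 else Var 0) (subst0 B (Var n)) = B.
  move=> pB; apply/prv_allI; apply: prv_mono pB => _ [C GC ->]; exists C => //.
  by apply: subst_eq_bounded (bG C GC) _ => x ->.
rewrite /subst0 subst_comp -[RHS]subst_id; apply: subst_eq_bounded bB _.
by case=> [|x]; rewrite /= ?ltnn // ltnS => ->.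
Qed.

Lemma prv_efq G A : prv G Bot -> prv G A.
Proof. by move=> p; apply: prv_contra; apply: prv_mono p => C; left. Qed.

Lemma prv_deduct G A B : prv G (Imp A B) -> prv (fun C => G C \/ C = A) B.
Proof.
move=> p; apply: prv_impE (prv_ax (or_intror erefl)).
by apply: prv_mono p => C; left.
Qed.

Lemma prv_trans G A B C : prv G (Imp A B) -> prv G (Imp B C) -> prv G (Imp A C).
Proof.
move=> pAB pBC; apply: prv_impI; apply: prv_impE (prv_deduct pAB).
by apply: prv_mono pBC => D; left.
Qed.

Lemma prv_iffr G A B : prv G (Iff A B) -> prv G (Imp B A).
Proof.
(* A conjunction is a negated implication. Its conclusion, the negation of [Imp B A], is just the
   assumption of the reductio, so the implication itself is at hand. *)
move=> p; apply: prv_contra; apply: prv_impE; first by apply: prv_mono p => C; left.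
by apply: prv_impI; apply: prv_ax; left; right.
Qed.

End Deduction.

(** * Henkin completeness *)

(* The common ground of Henkin sets of formulas and of relational structures
   evaluated through unwind.  Only the behaviour of the connectives and of
   renamings is kept: identity and the function symbols need not be interpreted
   as such. *)
Record satisfaction (S : signature) := Satisfaction {
  carrier : Type;
  point : carrier;
  indom : carrier -> Prop;
  sat : (nat -> carrier) -> form S -> Prop;
  sat_bot : forall rho, ~ sat rho Bot;
  sat_imp : forall rho A B, sat rho (Imp A B) <-> (sat rho A -> sat rho B);
  sat_all : forall rho A, sat rho (All A) <->
    (forall a, indom a -> sat (fun x => if x is y.+1 then rho y else a) A);
  sat_ren : forall n rho rho' g A, bounded n A ->
    (forall x, x < n -> rho x = rho' (g x)) ->
    sat rho A <-> sat rho' (subst (fun x => Var (g x)) A)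
}.

Section Completeness.
Variable S : signature.
Variable enum_form : nat -> form S.
Hypothesis enum_form_surj : forall A, exists k, enum_form k = A.
Variables (G : form S -> Prop) (phi : form S).
Hypothesis bG : forall A, G A -> bounded 0 A.
Hypothesis nphi : ~ prv G phi.

Definition extend (l : seq (form S)) : form S -> Prop := fun A => G A \/ List.In A l.

Definition bound (l : seq (form S)) : nat :=
  epsilon (inhabits 0) (fun n => forall A, List.In A l -> bounded n A).

Lemma boundP l A : extend l A -> bounded (bound l) A.
Proof.
case=> [/bG|]; first exact: bounded_mono.
suff: exists n, forall A, List.In A l -> bounded n A.
  by move/(epsilon_spec (inhabits 0)); apply.
elim: l {A} => [|B l [n bl]]; first by exists 0.
have [m bB] := ex_bounded B; exists (maxn m n) => A [<-|/bl].
  by apply: bounded_mono bB; apply: leq_maxl.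
by apply: bounded_mono; apply: leq_maxr.
Qed.

(** Free variables play the part of Henkin constants. [G] consists of sentences and only finitely
    many formulas have been added, so a fresh variable always exists and the language stays the
    same. The bound includes [A] itself, to keep the variable out of [B]. *)
Definition witness (l : seq (form S)) (A : form S) : seq (form S) :=
  if A is Imp (All B) Bot then [:: Neg (subst0 B (Var (bound (A :: l))))] else [::].

Fixpoint stage (k : nat) : seq (form S) :=
  if k is k'.+1 then
    let l := enum_form k' :: stage k' in
    if excluded_middle_informative (prv (extend l) Bot) then stage k'
    else witness (stage k') (enum_form k') ++ l
  else [:: Neg phi].

(** An equality of predicates, so that [prv_impI] and [prv_contra] apply after a rewrite. *)
Lemma extend_cons A l : extend (A :: l) = fun C => extend l C \/ C = A.
Proof.
apply: functional_extensionality => C; apply: propositional_extensionality.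
by rewrite /extend /=; split; intuition.
Qed.

Lemma stage_consistent k : ~ prv (extend (stage k)) Bot.
Proof.
elim: k => [|k IH] /=.
  rewrite extend_cons => /prv_contra p; apply: nphi.
  by apply: prv_mono p => C [].
case: excluded_middle_informative => // nincons.
set l := _ :: _ in nincons *; rewrite /witness.
case E: (enum_form k) => [|a|A B|A] //; case: A E => // A E; case: B E => // E.
(* If the witness made [l] inconsistent, [l] would prove the instance at a fresh variable, hence
   [All A], whose negation is in [l]. *)
rewrite /= extend_cons -E -/l => /prv_contra/prv_all_fresh pA; apply: nincons.
apply: prv_impE (_ : prv _ (Neg (All A))) _.
  by apply: prv_ax; right; left.
apply: pA => [C|]; first exact: boundP.
have: bounded (bound l) (enum_form k) by apply: boundP; right; left.
by rewrite E /= andbT.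
Qed.

(** Provability from a stage instead of membership in one, which gives deductive closure at once. *)
Definition true_form (A : form S) : Prop := exists k, prv (extend (stage k)) A.

Lemma stage_mono k m A : k <= m -> prv (extend (stage k)) A -> prv (extend (stage m)) A.
Proof.
move/subnK <-; elim: (m - k) => [|d IH] // /IH; apply: prv_mono => C /=.
case: excluded_middle_informative => //= _ [|inC]; first by left.
by right; apply: List.in_or_app; right; right.
Qed.

Lemma true_prv A : prv G A -> true_form A.
Proof. by move=> p; exists 0; apply: prv_mono p => C; left. Qed.

Lemma true_bot : ~ true_form Bot.
Proof. by case=> k; apply: stage_consistent. Qed.

Lemma true_mp A B : true_form (Imp A B) -> true_form A -> true_form B.
Proof.
move=> [k p] [m q]; exists (maxn k m); apply: prv_impE.
  by apply: stage_mono p; apply: leq_maxl.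
by apply: stage_mono q; apply: leq_maxr.
Qed.

Lemma true_or_neg A : true_form A \/ true_form (Neg A).
Proof.
have [k <-] := enum_form_surj A; set B := enum_form k.
have [p|np] := classic (prv (extend (B :: stage k)) Bot).
  by right; exists k; apply: prv_impI; rewrite -extend_cons.
left; exists k.+1; apply: prv_ax => /=.
case: excluded_middle_informative => //= _; right.
by apply: List.in_or_app; right; left.
Qed.

Lemma true_imp A B : true_form (Imp A B) <-> (true_form A -> true_form B).
Proof.
split; first exact: true_mp.
have [tA /(_ tA)[k p]|[k p] _] := true_or_neg A.
  by exists k; apply: prv_impI; apply: prv_mono p => C; left.
by exists k; apply/prv_impI/prv_efq/prv_deduct.
Qed.

(** If [All A] is not true, its negation is; the stage that treated this negation has also added a
    counterexample at a variable. *)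
Lemma true_all A : true_form (All A) <-> (forall t, true_form (subst0 A t)).
Proof.
split=> [[k p] t|tA]; first by exists k; apply: prv_allE.
case: (true_or_neg (All A)) => // tNA.
have [k Ek] := enum_form_surj (Neg (All A)).
suff tNA' : true_form (Neg (subst0 A (Var (bound (Neg (All A) :: stage k))))).
  by case: true_bot; apply: true_mp tNA' (tA _).
exists k.+1; apply: prv_ax; rewrite /= Ek.
case: excluded_middle_informative => [p|_] /=; last by right; left.
case: true_bot; apply: true_mp tNA; exists k.
by apply: prv_impI; rewrite -extend_cons.
Qed.

(** Valuations in terms are substitutions, so the renaming law is composition of substitutions. The
    definition is transparent because the next two lemmas compute with [sat]. *)
Definition henkin_satisfaction : satisfaction S.
Proof.
apply: (@Satisfaction S (term S) (Var 0) (fun=> True) (fun rho A => true_form (subst rho A))).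
- by move=> rho; apply: true_bot.
- by move=> rho A B; apply: true_imp.
- have eqA rho A t : subst0 (subst (up rho) A) t =
      subst (fun x => if x is y.+1 then rho y else t) A.
    rewrite /subst0 subst_comp; congr (subst _ A); apply: functional_extensionality.
    by case=> //= x; rewrite subst_term_comp subst_term_id.
  move=> rho A; split=> /= [/true_all tA t _|tA]; first by rewrite -eqA.
  by apply/true_all => t; rewrite eqA; apply: tA.
- move=> n rho rho' g A bA eq_rho; rewrite subst_comp /=.
  by rewrite (subst_eq_bounded bA eq_rho).
Defined.

Lemma henkin_refutes : ~ sat (s := henkin_satisfaction) Var phi.
Proof.
rewrite /= subst_id => tphi; apply: true_bot; apply: true_mp tphi.
by exists 0; apply: prv_ax; right; left.
Qed.

Lemma henkin_models A : prv G A -> sat (s := henkin_satisfaction) Var A.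
Proof. by rewrite /= subst_id; apply: true_prv. Qed.

End Completeness.

(** * Injectivity of the codes of terms and formulas *)

Section Codes.

Lemma pair_code_inj x y x' y' : pair_code x y = pair_code x' y' -> x = x' /\ y = y'.
Proof. by move/Cantor.to_nat_inj => [-> ->]. Qed.

Lemma seq_code_inj : injective seq_code.
Proof. by elim=> [|x s IH] [|y s'] //= [] /pair_code_inj [-> /IH ->]. Qed.

(** Injectivity of [c] is asked only at the values of [f], which is what an induction hypothesis on
    the arguments of a term offers. *)
Lemma seq_code_ffun_inj (A : Type) (c : A -> nat) n (f g : {ffun 'I_n -> A}) :
  (forall k y, c (f k) = c y -> f k = y) ->
  seq_code [seq c (f k) | k <- enum 'I_n] = seq_code [seq c (g k) | k <- enum 'I_n] ->
  f = g.
Proof.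
move=> inj_c /seq_code_inj eq_s; apply/ffunP => k; apply: inj_c.
have lt_k : k < size (enum 'I_n) by rewrite size_enum_ord.
have: nth 0 [seq c (f k) | k <- enum 'I_n] k = nth 0 [seq c (g k) | k <- enum 'I_n] k.
  by rewrite eq_s.
by rewrite 2!(nth_map k 0 _ lt_k) nth_ord_enum.
Qed.

Lemma term_code_inj S : injective (@term_code S).
Proof.
elim/term_ffun_ind => [x|f ts IH] [y|g us] /pair_code_inj[] //; first by move=> _ ->.
move=> _ /pair_code_inj[/val_inj eq_fg]; case: g / eq_fg us => us.
by move/seq_code_ffun_inj => -> // k y /IH.
Qed.

Lemma form_code_inj S : injective (@form_code S).
Proof.
elim=> [|a|A IHA B IHB|A IH] [|a'|A' B'|A'] //= /pair_code_inj[] // _.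
- case: a a' => [s t|r ts] [s' t'|r' ts'] /pair_code_inj[] // _.
    by move/pair_code_inj=> [/term_code_inj -> /term_code_inj ->].
  move=> /pair_code_inj[/val_inj eq_r]; case: r' / eq_r ts' => ts'.
  by move/seq_code_ffun_inj => -> // k y /term_code_inj.
- by move/pair_code_inj=> [/IHA -> /IHB ->].
- by move/IH ->.
Qed.

End Codes.

Lemma henkin_completeness S (G : form S -> Prop) (phi : form S) :
  (forall A, G A -> bounded 0 A) -> ~ prv G phi ->
  exists X : satisfaction S, exists rho,
    (forall A, prv G A -> sat (s := X) rho A) /\ ~ sat (s := X) rho phi.
Proof.
(* Choosing a formula with the given code enumerates all formulas, since codes are injective. *)
pose en k : form S := epsilon (inhabits Bot) (fun A => form_code A = k).
have en_surj A : exists k, en k = A.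
  exists (form_code A); apply: form_code_inj.
  exact: (epsilon_spec (inhabits Bot) (fun B => form_code B = form_code A) (ex_intro _ A erefl)).
move=> bG nphi; exists (henkin_satisfaction en_surj bG nphi), Var.
by split; [apply: henkin_models | apply: henkin_refutes].
Qed.

(** An arbitrary satisfaction may fail to validate theorems, as identity can be anything in it; but
    the Henkin set that refutes [B] contains the theorem [A]. This is why an implication is
    transported rather than validity. *)
Lemma proves_of_sat (W : theory) (A B : form (sig W)) :
  (forall (X : satisfaction (sig W)) rho,
    sat (s := X) rho A -> sat (s := X) rho B) ->
  proves A -> proves B.
Proof.
move=> AB pA; apply: NNPP => npB.
have [_ [C _ ->]|X [rho [mX nB]]] := henkin_completeness _ npB; first exact: valP C.
by apply/nB/AB/mX.
Qed.

(** * Flat structures *)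

Fixpoint all_of (T : Type) (P : T -> Prop) (s : seq T) : Prop :=
  if s is a :: s' then P a /\ all_of P s' else True.

Section AllOf.
Variable T : Type.
Implicit Types (P : T -> Prop) (s : seq T).

Lemma all_of_cat P s1 s2 : all_of P (s1 ++ s2) <-> all_of P s1 /\ all_of P s2.
Proof. by elim: s1 => [|a s1 IH] /=; [|rewrite IH]; tauto. Qed.

Lemma all_of_nth P s x0 : all_of P s <-> (forall x, x < size s -> P (nth x0 s x)).
Proof.
elim: s => //= a s IH; rewrite IH; split=> [[Pa Ps] [|x] //= /Ps //|Pas].
by split=> [|x lt_x]; [apply: (Pas 0)|apply: (Pas x.+1)].
Qed.

End AllOf.

Definition scons (T : Type) (a : T) (rho : nat -> T) (x : nat) : T :=
  if x is y.+1 then rho y else a.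

Definition ext (T : Type) (s : seq T) (rho : nat -> T) : nat -> T := foldr (@scons T) rho s.

Section Ext.
Variable T : Type.
Implicit Types (s : seq T) (rho : nat -> T).

Lemma ext_ge s rho n x : size s = n -> ext s rho (n + x) = rho x.
Proof. by move<-; elim: s => //= a s IH. Qed.

Lemma ext_lt s rho x0 x : x < size s -> ext s rho x = nth x0 s x.
Proof. by elim: s x => //= a s IH [|x] //=; apply: IH. Qed.

Lemma ext_iota s rho n : size s = n -> map (ext s rho) (iota 0 n) = s.
Proof.
move<-; case: s => // a s; apply: (@eq_from_nth _ a) => [|x]; rewrite size_map size_iota //.
by move=> lt_x; rewrite (nth_map 0) ?size_iota // nth_iota // add0n (ext_lt _ a).
Qed.

End Ext.

(** * Derived connectives under any satisfaction relation with relativised quantifiers *)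

Section Connectives.
Variables (At D : Type) (dom : D -> Prop) (holds : (nat -> D) -> fm At -> Prop).
Hypothesis holds_bot : forall rho, ~ holds rho Bot.
Hypothesis holds_imp : forall rho A B,
  holds rho (Imp A B) <-> (holds rho A -> holds rho B).
Hypothesis holds_all : forall rho A,
  holds rho (All A) <-> (forall a, dom a -> holds (scons a rho) A).

Lemma holds_neg rho A : holds rho (Neg A) <-> ~ holds rho A.
Proof. by rewrite /Neg holds_imp; split=> nA /nA // /holds_bot. Qed.

Lemma holds_and rho A B : holds rho (And A B) <-> holds rho A /\ holds rho B.
Proof. by rewrite holds_neg holds_imp holds_neg; tauto. Qed.

Lemma holds_conj (I : eqType) (F : I -> fm At) (s : seq I) rho :
  holds rho (Conj [seq F i | i <- s]) <-> (forall i, i \in s -> holds rho (F i)).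
Proof.
elim: s => [|i s IH] /=; first by split=> // _; rewrite holds_imp.
rewrite holds_and IH; split=> [[hi hs] j|h].
  by rewrite inE => /predU1P[->|/hs].
by split=> [|j sj]; apply: h; rewrite inE ?eqxx ?sj ?orbT.
Qed.

Lemma holds_conj_enum (I : finType) (F : I -> fm At) rho :
  holds rho (Conj [seq F i | i <- enum I]) <-> (forall i, holds rho (F i)).
Proof.
by rewrite holds_conj; split=> h i => [|_]; apply: h; rewrite ?mem_enum.
Qed.

Lemma holds_alls n A rho :
  holds rho (Alls n A) <->
  (forall s, size s = n -> all_of dom s -> holds (ext s rho) A).
Proof.
elim: n rho => [|n IH] rho /=.
  by split=> [h [|//] _ _|h] //; apply: (h [::]).
rewrite holds_all; split=> [h s|h a da].
  (* The outermost quantifier binds the last entry of the list, the innermost one the first. *)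
  case/lastP: s => // s a; rewrite size_rcons -cats1 => - [sz] /all_of_cat[ds [da _]].
  by rewrite /ext foldr_cat; move/(_ _ da)/IH: h; apply.
apply/IH => s sz ds; have := h (rcons s a).
rewrite size_rcons sz -cats1 /ext foldr_cat; apply=> //.
by apply/all_of_cat.
Qed.

Lemma holds_ex A rho :
  holds rho (Ex A) <-> exists2 a, dom a & holds (scons a rho) A.
Proof.
rewrite holds_neg holds_all; split=> [n|[a da ha] n]; last first.
  by have := n a da; rewrite holds_neg.
by apply: NNPP => nex; apply: n => a da; rewrite holds_neg => ha; apply: nex; exists a.
Qed.

Lemma holds_exs n A rho :
  holds rho (Exs n A) <->
  exists s, [/\ size s = n, all_of dom s & holds (ext s rho) A].
Proof.
elim: n rho => [|n IH] rho /=.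
  by split=> [h|[[|a s] [//]]] //; exists [::].
rewrite holds_ex; split=> [[a da /IH[s [sz ds hs]]]|[s []]].
  exists (rcons s a); rewrite size_rcons sz -cats1 /ext foldr_cat; split=> //.
  by apply/all_of_cat.
case/lastP: s => // s a; rewrite size_rcons -cats1 => - [sz] /all_of_cat[ds [da _]].
by rewrite /ext foldr_cat => h; exists a => //; apply/IH; exists s.
Qed.

End Connectives.

Record flat_structure (S : signature) := FlatStructure {
  fcarrier : Type;
  fpoint : fcarrier;
  fdom : fcarrier -> Prop;
  feq : fcarrier -> fcarrier -> Prop;
  frel : forall r : rsym S, ('I_(rar r) -> fcarrier) -> Prop;
  fgraph : forall f : fsym S, ('I_(far f) -> fcarrier) -> fcarrier -> Prop
}.

Section FlatSatisfaction.
Variables (S : signature) (F : flat_structure S).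

Definition fsat_atom (rho : nat -> fcarrier F) (a : flat_atom S) : Prop :=
  match a with
  | FEq x y => feq (rho x) (rho y)
  | FRel r xs => frel (fun k => rho (xs k))
  | FFun f xs y => fgraph (fun k => rho (xs k)) (rho y)
  end.

Fixpoint fsat (rho : nat -> fcarrier F) (A : fm (flat_atom S)) : Prop :=
  match A with
  | Bot => False
  | Atom a => fsat_atom rho a
  | Imp A B => fsat rho A -> fsat rho B
  | All A => forall a, fdom a -> fsat (scons a rho) A
  end.

Fact fsat_bot rho : ~ fsat rho Bot. Proof. by []. Qed.
Fact fsat_imp rho A B : fsat rho (Imp A B) <-> (fsat rho A -> fsat rho B).
Proof. by []. Qed.
Fact fsat_all rho A :
  fsat rho (All A) <-> (forall a, fdom a -> fsat (scons a rho) A).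
Proof. by []. Qed.

Definition fsat_and := holds_and fsat_bot fsat_imp.
Definition fsat_conj_enum := holds_conj_enum fsat_bot fsat_imp.
Definition fsat_ex := holds_ex fsat_bot fsat_imp fsat_all.
Definition fsat_exs := holds_exs fsat_bot fsat_imp fsat_all.

Lemma is_var_ren (g : nat -> nat) (t : term S) :
  is_var (subst_term (fun x => Var (g x)) t) = is_var t.
Proof. by case: t. Qed.

Lemma var_index_ren (g : nat -> nat) (t : term S) : is_var t ->
  var_index (subst_term (fun x => Var (g x)) t) = g (var_index t).
Proof. by case: t. Qed.

Lemma bounded_var_index n (t : term S) : is_var t -> bounded_term n t = (var_index t < n).
Proof. by case: t. Qed.

(** Renamings, unlike substitutions in general, keep the distinction between variables and compound
    arguments on which [unwind_term] branches. Offsets, value variables and valuations vary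
    independently on the two sides, so that the induction passes under the block of quantifiers. *)
Lemma fsat_unwind_term n g t d d' y y' rho rho' :
  bounded_term n t -> (forall x, x < n -> rho (d + x) = rho' (d' + g x)) ->
  rho y = rho' y' ->
  fsat rho (unwind_term d t y) <->
  fsat rho' (unwind_term d' (subst_term (fun x => Var (g x)) t) y').
Proof.
elim/term_ffun_ind: t d d' y y' rho rho' => [x|f ts IH] d d' y y' rho rho' /=.
  by move=> lt_x /(_ _ lt_x) -> ->.
move=> /forallP bt eq_rho eq_y.
under [in X in _ <-> X]eq_forallb do rewrite ffunE is_var_ren.
case: ifP => [/forallP vts|_] /=.
  rewrite eq_y; suff -> : (fun k => rho ([ffun k0 => d + var_index (ts k0)] k)) =
    fun k => rho' ([ffun k0 => d' + var_index ([ffun k1 =>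
      subst_term (fun x => Var (g x)) (ts k1)] k0)] k) by [].
  apply: functional_extensionality => k.
  by rewrite !ffunE var_index_ren // eq_rho // -bounded_var_index.
rewrite !fsat_exs.
suff core s : size s = far f ->
    (fsat (ext s rho) (And (Conj [seq unwind_term (far f + d) (ts k) k | k <- enum 'I_(far f)])
       (Atom (FFun f [ffun k => val k] (far f + y)))) <->
     fsat (ext s rho') (And (Conj [seq unwind_term (far f + d')
         ([ffun k0 => subst_term (fun x => Var (g x)) (ts k0)] k) k | k <- enum 'I_(far f)])
       (Atom (FFun f [ffun k => val k] (far f + y'))))).
  by split=> - [s [sz ds /(core s sz) h]]; exists s.
move=> sz; rewrite !fsat_and !fsat_conj_enum /= !ext_ge // eq_y.
have lt_ext k r : k < far f -> ext s r k = nth (fpoint F) s k.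
  by move=> lt_k; rewrite (ext_lt _ (fpoint F)) ?sz.
have -> : (fun k => ext s rho ([ffun k0 : 'I_(far f) => val k0] k)) =
          (fun k => ext s rho' ([ffun k0 : 'I_(far f) => val k0] k)).
  by apply: functional_extensionality => k; rewrite ffunE /= !lt_ext.
have IHs k : fsat (ext s rho) (unwind_term (far f + d) (ts k) k) <->
    fsat (ext s rho') (unwind_term (far f + d')
       ([ffun k0 => subst_term (fun x => Var (g x)) (ts k0)] k) k).
  rewrite ffunE; apply: IH => // [x lt_x|]; last by rewrite !lt_ext.
  by rewrite -!addnA !ext_ge ?eq_rho.
by split=> - [h1 h2]; split=> // k; apply/IHs.
Qed.

Lemma fsat_unwind n g A rho rho' :
  bounded n A -> (forall x, x < n -> rho x = rho' (g x)) ->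
  fsat rho (unwind A) <-> fsat rho' (unwind (subst (fun x => Var (g x)) A)).
Proof.
elim: A n g rho rho' => [|[s t|r ts]|A IHA B IHB|A IH] n g rho rho' //= bA eq_rho.
- case/andP: bA => bs bt.
  have core : fsat rho (Ex (And (unwind_term 1 t 0) (unwind_term 1 s 0))) <->
      fsat rho' (Ex (And (unwind_term 1 (subst_term (fun x => Var (g x)) t) 0)
                         (unwind_term 1 (subst_term (fun x => Var (g x)) s) 0))).
    have IH a u : bounded_term n u -> fsat (scons a rho) (unwind_term 1 u 0) <->
        fsat (scons a rho') (unwind_term 1 (subst_term (fun x => Var (g x)) u) 0).
      by move=> b; apply: fsat_unwind_term b _ _.
    rewrite !fsat_ex; split=> - [a da]; rewrite fsat_and => - [h1 h2]; exists a => //;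
      by rewrite fsat_and; split; apply/IH.
  case: t bt core => [y|f ts] bt core; last exact: core.
  by apply: fsat_unwind_term bs _ _; rewrite ?eq_rho.
- move/forallP: bA => bts.
  under [in X in _ <-> X]eq_forallb do rewrite ffunE is_var_ren.
  case: ifP => [/forallP vts|_] /=.
    suff -> : (fun k => rho ([ffun k0 => var_index (ts k0)] k)) =
      fun k => rho' ([ffun k0 => var_index ([ffun k1 =>
        subst_term (fun x => Var (g x)) (ts k1)] k0)] k) by [].
    apply: functional_extensionality => k.
    by rewrite !ffunE var_index_ren // eq_rho // -bounded_var_index.
  rewrite !fsat_exs.
  suff core s : size s = rar r ->
    (fsat (ext s rho) (And (Conj [seq unwind_term (rar r) (ts k) k | k <- enum 'I_(rar r)])
       (Atom (FRel r [ffun k => val k]))) <->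
     fsat (ext s rho') (And (Conj [seq unwind_term (rar r)
         ([ffun k0 => subst_term (fun x => Var (g x)) (ts k0)] k) k | k <- enum 'I_(rar r)])
       (Atom (FRel r [ffun k => val k])))).
    by split=> - [s [sz ds /(core s sz) h]]; exists s.
  move=> sz; rewrite !fsat_and !fsat_conj_enum /=.
  have lt_ext k q : k < rar r -> ext s q k = nth (fpoint F) s k.
    by move=> lt_k; rewrite (ext_lt _ (fpoint F)) ?sz.
  have -> : (fun k => ext s rho ([ffun k0 : 'I_(rar r) => val k0] k)) =
            (fun k => ext s rho' ([ffun k0 : 'I_(rar r) => val k0] k)).
    by apply: functional_extensionality => k; rewrite ffunE /= !lt_ext.
  have IHs k : fsat (ext s rho) (unwind_term (rar r) (ts k) k) <->
      fsat (ext s rho') (unwind_term (rar r)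
         ([ffun k0 => subst_term (fun x => Var (g x)) (ts k0)] k) k).
    rewrite ffunE; apply: fsat_unwind_term (bts k) _ _ => [x lt_x|]; last by rewrite !lt_ext.
    by rewrite !ext_ge ?eq_rho.
  by split=> - [h1 h2]; split=> // k; apply/IHs.
- case/andP: bA => bA bB.
  by rewrite (IHA n g rho rho') // (IHB n g rho rho').
- have -> : up (fun x => Var (g x)) =
      fun x => @Var S (if x is y.+1 then (g y).+1 else 0).
    by apply: functional_extensionality => - [].
  have IH' a : fsat (scons a rho) (unwind A) <-> fsat (scons a rho')
      (unwind (subst (fun x => Var (if x is y.+1 then (g y).+1 else 0)) A)).
    by apply: IH bA _ => - [|x] //=; rewrite ltnS => /eq_rho.
  by split=> h a da; apply/IH'/h.
Qed.

(** This closes the circle: the structure induced by one translation can serve as the model to which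
    a second translation is applied. *)
Definition unwound : satisfaction S :=
  @Satisfaction S (fcarrier F) (fpoint F) (@fdom S F) (fun rho A => fsat rho (unwind A))
    fsat_bot (fun rho A B => fsat_imp rho (unwind A) (unwind B))
    (fun rho A => fsat_all rho (unwind A))
    (fun n rho rho' g A => @fsat_unwind n g A rho rho').

End FlatSatisfaction.

(** * Invariance of flat formulas under bisimulation *)

Section Bisimulation.
Variables (S : signature) (F F' : flat_structure S).
Variable R : fcarrier F -> fcarrier F' -> Prop.
Hypothesis R_eq : forall a a' b b', R a a' -> R b b' -> feq a b <-> feq a' b'.
Hypothesis R_rel : forall (r : rsym S) (as_ : 'I_(rar r) -> _) as',
  (forall k, R (as_ k) (as' k)) -> frel as_ <-> frel as'.
Hypothesis R_graph : forall (f : fsym S) (as_ : 'I_(far f) -> _) as' b b',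
  (forall k, R (as_ k) (as' k)) -> R b b' -> fgraph as_ b <-> fgraph as' b'.
Hypothesis R_forth : forall a, fdom a -> exists2 a', fdom a' & R a a'.
Hypothesis R_back : forall a', fdom a' -> exists2 a, fdom a & R a a'.

Definition fbounded_atom (n : nat) (a : flat_atom S) : bool :=
  match a with
  | FEq x y => (x < n) && (y < n)
  | FRel r xs => [forall k, xs k < n]
  | FFun f xs y => [forall k, xs k < n] && (y < n)
  end.

Fixpoint fbounded (n : nat) (A : fm (flat_atom S)) : bool :=
  match A with
  | Bot => true
  | Atom a => fbounded_atom n a
  | Imp A B => fbounded n A && fbounded n B
  | All A => fbounded n.+1 A
  end.

(** Identity counts as one more relation to be preserved, so [R] may relate an element to many
    others. *)
Lemma fsat_bisim n A rho rho' :
  fbounded n A -> (forall x, x < n -> R (rho x) (rho' x)) ->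
  fsat rho A <-> fsat rho' A.
Proof.
elim: A n rho rho' => [|[x y|r xs|f xs y]|A IHA B IHB|A IH] n rho rho' //= bA R_rho.
- by case/andP: bA => lt_x lt_y; apply: R_eq; apply: R_rho.
- by apply: R_rel => k; apply: R_rho; apply: (forallP bA).
- by case/andP: bA => /forallP lt_x lt_y; apply: R_graph => [k|]; apply: R_rho.
- by case/andP: bA => bA bB; rewrite (IHA n rho rho') // (IHB n rho rho').
- have IH' a a' : R a a' -> fsat (scons a rho) A <-> fsat (scons a' rho') A.
    by move=> Ra; apply: IH bA _ => - [|x] //; rewrite ltnS; apply: R_rho.
  split=> h a da.
    by have [b db /IH' <-] := R_back da; apply: h.
  by have [b db /IH' ->] := R_forth da; apply: h.
Qed.

End Bisimulation.

Section FlatBounded.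
Variable S : signature.
Implicit Types (A B : fm (flat_atom S)) (n : nat).

Lemma fbounded_and n A B : fbounded n (And A B) = fbounded n A && fbounded n B.
Proof. by rewrite /And /= !andbT. Qed.

Lemma fbounded_conj (I : Type) (G : I -> fm (flat_atom S)) (s : seq I) n :
  (forall i, fbounded n (G i)) -> fbounded n (Conj [seq G i | i <- s]).
Proof. by move=> bG; elim: s => //= i s IH; rewrite bG IH. Qed.

Lemma fbounded_exs m n A : fbounded n (Exs m A) = fbounded (m + n) A.
Proof. by elim: m n => //= m IH n; rewrite /Ex /= !andbT IH addnS. Qed.

Lemma fbounded_unwind_term m n d (t : term S) y :
  bounded_term m t -> d + m <= n -> y < n -> fbounded n (unwind_term d t y).
Proof.
elim/term_ffun_ind: t n d y => [x|f ts IH] n d y /= bt le_n lt_y.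
  by rewrite lt_y andbT; apply: leq_trans le_n; rewrite ltn_add2l.
move/forallP: bt => bt; case: ifP => [/forallP vts|_] /=.
  rewrite lt_y andbT; apply/forallP => k; rewrite ffunE.
  by apply: leq_trans le_n; rewrite ltn_add2l -bounded_var_index.
rewrite fbounded_exs fbounded_and fbounded_conj => [|k] /=.
  rewrite ltn_add2l lt_y andbT; apply/forallP => k; rewrite ffunE.
  exact: leq_trans (ltn_ord k) (leq_addr _ _).
apply: IH => //; first by rewrite -addnA leq_add2l.
exact: leq_trans (ltn_ord k) (leq_addr _ _).
Qed.

Lemma fbounded_unwind n (A : form S) : bounded n A -> fbounded n (unwind A).
Proof.
elim: A n => [|[s t|r ts]|A IHA B IHB|A IH] n //=; last exact: IH.
- case/andP=> bs bt; case: t bt => [y|f ts] bt.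
    exact: (fbounded_unwind_term bs).
  have := fbounded_unwind_term (n := n.+1) (d := 1) (y := 0) bt.
  rewrite add1n leqnn => /(_ isT isT) b1.
  rewrite -[Ex _]/(Exs 1 _) fbounded_exs fbounded_and b1.
  exact: (fbounded_unwind_term bs).
- move/forallP => bt; case: ifP => [/forallP vts|_] /=.
    by apply/forallP => k; rewrite ffunE -bounded_var_index.
  rewrite fbounded_exs fbounded_and fbounded_conj => [|k] /=.
    apply/forallP => k; rewrite ffunE.
    exact: leq_trans (ltn_ord k) (leq_addr _ _).
  apply: fbounded_unwind_term (bt k) _ _ => //.
  exact: leq_trans (ltn_ord k) (leq_addr _ _).
- by case/andP=> /IHA -> /IHB ->.
Qed.

End FlatBounded.

(** * Structures induced by translations *)

Section SatConnectives.
Variables (S : signature) (X : satisfaction S).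

Definition sat_and := holds_and (@sat_bot S X) (@sat_imp S X).
Definition sat_conj := holds_conj (@sat_bot S X) (@sat_imp S X).
Definition sat_conj_enum := holds_conj_enum (@sat_bot S X) (@sat_imp S X).
Definition sat_alls := holds_alls (@sat_all S X).

(** The renaming law at the identity. *)
Lemma sat_eq_bounded n rho rho' (A : form S) :
  bounded n A -> (forall x, x < n -> rho x = rho' x) ->
  sat (s := X) rho A <-> sat (s := X) rho' A.
Proof. by move=> bA eq_rho; rewrite (sat_ren (g := id) bA eq_rho) subst_id. Qed.

Lemma sat_inst (A : form S) (xs : seq nat) rho : bounded (size xs) A ->
  sat (s := X) rho (inst A xs) <-> sat (s := X) (nth (point X) (map rho xs)) A.
Proof.
move=> bA; apply: iff_sym; apply: sat_ren bA _ => x lt_x.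
by rewrite (nth_map 0).
Qed.

End SatConnectives.

Section Dimensions.
Variables (S T : signature) (K : translation S T).
Implicit Types (e : seq (piece K)).

Definition total_dim e : nat := sumn [seq tr_dim i | i <- e].

Lemma total_dim_cat e1 e2 : total_dim (e1 ++ e2) = total_dim e1 + total_dim e2.
Proof. by rewrite /total_dim map_cat sumn_cat. Qed.

Lemma total_dim_flatten (I : finType) (p : I -> seq (piece K)) :
  total_dim (flatten [seq p k | k <- enum I]) = \sum_k total_dim (p k).
Proof.
rewrite -big_enum /=; elim: (enum I) => [|k s IH] /=; first by rewrite big_nil.
by rewrite total_dim_cat IH big_cons.
Qed.

Lemma block_cons i e x : block (i :: e) x.+1 = map (addn (tr_dim i)) (block e x).
Proof. by rewrite /block /= iotaDl. Qed.

Lemma size_block e x : size (block e x) = tr_dim (piece_of e x).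
Proof. exact: size_iota. Qed.

Lemma block_bound e x : x < size e -> all (gtn (total_dim e)) (block e x).
Proof.
elim: e x => // i e IH [_|x lt_x].
  apply/allP => y; rewrite mem_iota add0n /= => lt_y.
  exact: leq_trans lt_y (leq_addr _ _).
rewrite block_cons all_map; apply: sub_all (IH x lt_x) => y /=.
by rewrite /total_dim /= ltn_add2l.
Qed.

Lemma size_flatten_block (I : finType) e (x : I -> nat) :
  size (flatten [seq block e (x k) | k <- enum I]) =
  \sum_k tr_dim ([ffun j => piece_of e (x j)] k).
Proof.
rewrite -big_enum /=; elim: (enum I) => [|k s IH] /=; first by rewrite big_nil.
by rewrite size_cat size_block IH big_cons ffunE.
Qed.

End Dimensions.

Section BoundedTranslate.
Variables (S T : signature) (K : translation S T).
Implicit Types (e : seq (piece K)) (A : form T).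

Lemma bounded_subst_term m n s (t : term T) :
  bounded_term m t -> (forall x, x < m -> bounded_term n (s x)) ->
  bounded_term n (subst_term s t).
Proof.
move=> bt bs; elim/term_ffun_ind: t bt => [x|f ts IH] /=; first exact: bs.
by move/forallP=> bt; apply/forallP => k; rewrite ffunE IH.
Qed.

Lemma bounded_subst m n s A :
  bounded m A -> (forall x, x < m -> bounded_term n (s x)) -> bounded n (subst s A).
Proof.
elim: A m n s => [|[t1 t2|r ts]|A IHA B IHB|A IH] m n s //= bA bs.
- by case/andP: bA => b1 b2; rewrite !(bounded_subst_term _ bs).
- apply/forallP => k; rewrite ffunE; exact: bounded_subst_term (forallP bA k) bs.
- by case/andP: bA => bA bB; rewrite (IHA m) ?(IHB m).
- apply: IH bA _ => - [|x] //=; rewrite ltnS => /bs b.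
  exact: bounded_subst_term b _.
Qed.

Lemma bounded_inst n A xs :
  bounded (size xs) A -> all (gtn n) xs -> bounded n (inst A xs).
Proof.
move=> bA /allP lt_xs; apply: bounded_subst bA _ => x lt_x /=.
exact/lt_xs/mem_nth.
Qed.

Lemma bounded_and n A B : bounded n (And A B) = bounded n A && bounded n B.
Proof. by rewrite /= !andbT. Qed.

Lemma bounded_conj (I : eqType) (G : I -> form T) (s : seq I) n :
  (forall i, i \in s -> bounded n (G i)) -> bounded n (Conj [seq G i | i <- s]).
Proof.
elim: s => // i s IH bG; rewrite [Conj _]/= bounded_and bG ?mem_head // IH // => j sj.
by apply: bG; rewrite inE sj orbT.
Qed.

Lemma bounded_alls m n A : bounded n (Alls m A) = bounded (m + n) A.
Proof. by elim: m n => //= m IH n; rewrite IH addnS. Qed.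

Lemma bounded_translate_flat e (A : fm (flat_atom S)) :
  fbounded (size e) A -> bounded (total_dim e) (translate_flat e A).
Proof.
elim: A e => [|[x y|r xs|f xs y]|A IHA B IHB|A IH] e //=.
- case/andP=> lt_x lt_y; apply: bounded_inst.
    by rewrite size_cat !size_block tr_eq_bounded.
  by rewrite all_cat !block_bound.
- move/forallP=> lt_xs; apply: bounded_inst.
    rewrite size_flatten_block.
    exact: tr_rel_bounded.
  by apply/allP => z /flatten_mapP[k _]; apply/allP/block_bound.
- case/andP=> /forallP lt_xs lt_y; apply: bounded_inst.
    rewrite size_cat size_flatten_block size_block.
    exact: tr_fun_bounded.
  rewrite all_cat block_bound // andbT.
  by apply/allP => z /flatten_mapP[k _]; apply/allP/block_bound.
- by case/andP=> /IHA -> /IHB ->.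
- move=> bA; apply: bounded_conj => i _; rewrite bounded_alls /=.
  rewrite (bounded_mono _ (tr_dom_bounded i)) ?leq_addr //=.
  exact: IH (i :: e) bA.
Qed.

Lemma bounded_translate (A : form S) : bounded 0 A -> bounded 0 (translate K A).
Proof. move/fbounded_unwind; exact: (@bounded_translate_flat [::]). Qed.

End BoundedTranslate.

Section Induced.
Variables (S T : signature) (K : translation S T) (X : satisfaction T).

(* The domain of a piece is cut out by fdom, so that tuples of the wrong length
   are harmless elements of the carrier. *)
Definition induced : flat_structure S :=
  let D := (piece K * seq (carrier X))%type in
  @FlatStructure S D (ord0, [::])
    (fun c => [/\ size c.2 = tr_dim c.1, all_of (@indom T X) c.2 &
                  sat (nth (point X) c.2) (tr_dom c.1)])
    (fun c d => sat (nth (point X) (c.2 ++ d.2)) (tr_eq c.1 d.1))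
    (fun r cs => sat (nth (point X) (flatten [seq (cs k).2 | k <- enum 'I_(rar r)]))
                     (tr_rel [ffun k => (cs k).1]))
    (fun f cs d => sat (nth (point X) (flatten [seq (cs k).2 | k <- enum 'I_(far f)] ++ d.2))
                       (tr_fun [ffun k => (cs k).1] d.1)).

Definition read (e : seq (piece K)) (rho : nat -> carrier X) (x : nat) : fcarrier induced :=
  (piece_of e x, map rho (block e x)).

(** In the quantifier case, a block of target quantifiers prepends a tuple to the valuation, and
    [read] sees this tuple as one new element of the induced structure. For variables beyond [e]
    both sides fall back on the same default piece. *)
Lemma sat_translate_flat e A rho :
  sat rho (translate_flat e A) <-> fsat (F := induced) (read e rho) A.
Proof.
elim: A e rho => [|[x y|r xs|f xs y]|A IHA B IHB|A IH] e rho.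
- by split=> // /sat_bot.
- rewrite /= sat_inst ?map_cat //.
  by rewrite size_cat !size_block tr_eq_bounded.
- rewrite /= sat_inst.
    by rewrite map_flatten -map_comp.
  rewrite size_flatten_block.
  exact: tr_rel_bounded.
- rewrite /= sat_inst.
    by rewrite map_cat map_flatten -map_comp.
  rewrite size_cat size_flatten_block size_block.
  exact: tr_fun_bounded.
- by rewrite /= sat_imp IHA IHB.
- rewrite [translate_flat e _]/= sat_conj_enum.
  have ext_read i s : size s = tr_dim i ->
      read (i :: e) (ext s rho) = scons ((i, s) : fcarrier induced) (read e rho).
    move=> sz; apply: functional_extensionality => - [|x]; rewrite /read /scons.
      by rewrite /block /= ext_iota.
    rewrite block_cons -map_comp; congr (_, _).
    by apply: eq_map => y /=; apply: ext_ge.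
  have dom_ext i s : size s = tr_dim i ->
      sat (s := X) (ext s rho) (tr_dom i) <-> sat (s := X) (nth (point X) s) (tr_dom i).
    move=> sz; apply: sat_eq_bounded (tr_dom_bounded i) _ => x.
    by rewrite -sz; apply: ext_lt.
  split=> [h [i s] [/= sz ds dom_s]|h i].
    have := h i; rewrite sat_alls => /(_ s sz ds).
    by rewrite sat_imp dom_ext // IH ext_read //; apply.
  rewrite sat_alls => s sz ds; rewrite sat_imp dom_ext // IH ext_read // => dom_s.
  exact: h.
Qed.

(** What [block] does to variables, this does to values: it splits a tuple over the target into
    consecutive source elements. *)
Fixpoint chunk (e : seq (piece K)) (s : seq (carrier X)) : seq (fcarrier induced) :=
  if e is i :: e' then (i, take (tr_dim i) s) :: chunk e' (drop (tr_dim i) s) else [::].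

Lemma size_chunk e s : size (chunk e s) = size e.
Proof. by elim: e s => //= i e IH s; rewrite IH. Qed.

Lemma chunk_cat e1 e2 s1 s2 : size s1 = total_dim e1 ->
  chunk (e1 ++ e2) (s1 ++ s2) = chunk e1 s1 ++ chunk e2 s2.
Proof.
rewrite /total_dim; elim: e1 s1 => [|i e IH] s1 /= sz; first by rewrite (size0nil sz).
have dropE : drop (tr_dim i) (s1 ++ s2) = drop (tr_dim i) s1 ++ s2.
  rewrite -{1}(cat_take_drop (tr_dim i) s1) -catA drop_size_cat //.
  by rewrite size_takel // sz leq_addr.
by rewrite takel_cat ?sz ?leq_addr // dropE IH // size_drop sz addKn.
Qed.

Lemma chunk_flatten (I : Type) (e : I -> seq (piece K)) (s : I -> seq (carrier X)) (r : seq I) :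
  (forall k, size (s k) = total_dim (e k)) ->
  chunk (flatten [seq e k | k <- r]) (flatten [seq s k | k <- r]) =
  flatten [seq chunk (e k) (s k) | k <- r].
Proof. by move=> sz; elim: r => //= k r IH; rewrite chunk_cat // IH. Qed.

Lemma nth_chunk d e s x : size s = total_dim e -> x < size e ->
  nth d (chunk e s) x = read e (nth (point X) s) x.
Proof.
rewrite /total_dim; elim: e s x => //= i e IH s [|x] sz lt_x /=.
  rewrite /read /block /=; congr (_, _).
  by rewrite map_nth_iota0 // sz leq_addr.
rewrite IH // ?size_drop ?sz ?addKn // /read block_cons -map_comp; congr (_, _).
by apply: eq_map => y /=; rewrite nth_drop.
Qed.

Lemma chunkK (c : seq (fcarrier induced)) : all_of (@fdom S induced) c ->
  chunk (map fst c) (flatten (map snd c)) = c.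
Proof.
elim: c => [|[i s] c IH] //= [[/= sz _ _] /IH eq_c].
by rewrite -sz take_size_cat // drop_size_cat // eq_c.
Qed.

Lemma size_flatten_snd (c : seq (fcarrier induced)) : all_of (@fdom S induced) c ->
  size (flatten (map snd c)) = total_dim (map fst c).
Proof.
by elim: c => [|[i s] c IH] //= [[/= sz _ _] /IH eq_c]; rewrite size_cat sz eq_c.
Qed.

Lemma indom_chunk e s : size s = total_dim e ->
  all_of (fun c : fcarrier induced => all_of (@indom T X) c.2) (chunk e s) <->
  all_of (@indom T X) s.
Proof.
rewrite /total_dim; elim: e s => [|i e IH] s /= sz; first by rewrite (size0nil sz).
by rewrite IH ?size_drop ?sz ?addKn // -all_of_cat cat_take_drop.
Qed.

(** The shape in which the defining formulas of a composition are evaluated: a flat tuple on one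
    side, a tuple of elements of the induced structure on the other. *)
Lemma sat_chunk e s (A : form S) : size s = total_dim e -> bounded (size e) A ->
  sat (nth (point X) s) (translate_flat e (unwind A)) <->
  sat (s := unwound induced) (nth (fpoint induced) (chunk e s)) A.
Proof.
move=> sz bA; rewrite sat_translate_flat.
apply: (sat_eq_bounded (X := unwound induced) bA) => x lt_x.
by rewrite nth_chunk.
Qed.

End Induced.

Arguments chunk {S T K} X e s.
Arguments read {S T K} X e rho x.

(** * Composition of interpretations *)

Section Composition.
Variables (S T R : signature) (K : translation S T) (M : translation T R).

Definition max_dim : nat := \max_(i : piece K) tr_dim i.

(* A piece of the composition is a piece of K with a choice of a piece of M for
   each coordinate.  All choices have the same length max_dim, whose irrelevant
   part is dropped by coord_pieces; this yields redundant pieces, but avoids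
   dependent types. *)
Definition comp_piece := (piece K * max_dim.-tuple (piece M))%type.

Definition comp_pred_pieces : nat := #|{: comp_piece}|.-1.

(** The record [translation] numbers its pieces, so the finite type of composed pieces is
    enumerated. It is inhabited, hence its cardinality is a successor. *)
Definition comp_decode (i : 'I_comp_pred_pieces.+1) : comp_piece :=
  nth (ord0, [tuple ord0 | _ < max_dim]) (enum {: comp_piece}) i.

Lemma comp_decode_surj c : exists i, comp_decode i = c.
Proof.
have lt_c : index c (enum {: comp_piece}) < comp_pred_pieces.+1.
  rewrite prednK; first by rewrite cardE index_mem mem_enum.
  by apply/card_gt0P; exists c.
by exists (Ordinal lt_c); rewrite /comp_decode nth_index ?mem_enum.
Qed.

Definition coord_pieces (c : comp_piece) : seq (piece M) := take (tr_dim c.1) c.2.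

Lemma size_coord_pieces c : size (coord_pieces c) = tr_dim c.1.
Proof. by rewrite size_takel // size_tuple /max_dim; apply: leq_bigmax. Qed.

Definition comp_env (i : 'I_comp_pred_pieces.+1) := coord_pieces (comp_decode i).

Definition comp_dim i : nat := total_dim (comp_env i).

(** [translate_flat] relativises quantifiers but leaves free variables unrestricted, so the first
    conjunct has to place every coordinate in the domain of its piece of [M]. *)
Definition comp_dom i : form R :=
  And (Conj [seq inst (tr_dom (piece_of (comp_env i) x)) (block (comp_env i) x)
            | x <- iota 0 (size (comp_env i))])
      (translate_flat (comp_env i) (unwind (tr_dom (comp_decode i).1))).

Definition comp_eq i j : form R :=
  translate_flat (comp_env i ++ comp_env j)
    (unwind (tr_eq (comp_decode i).1 (comp_decode j).1)).

Definition comp_rel (r : rsym S) (p : {ffun 'I_(rar r) -> 'I_comp_pred_pieces.+1}) : form R :=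
  translate_flat (flatten [seq comp_env (p k) | k <- enum 'I_(rar r)])
    (unwind (tr_rel [ffun k => (comp_decode (p k)).1])).

Definition comp_fun (f : fsym S) (p : {ffun 'I_(far f) -> 'I_comp_pred_pieces.+1}) i : form R :=
  translate_flat (flatten [seq comp_env (p k) | k <- enum 'I_(far f)] ++ comp_env i)
    (unwind (tr_fun [ffun k => (comp_decode (p k)).1] (comp_decode i).1)).

Lemma size_comp_envs (I : finType) (p : I -> 'I_comp_pred_pieces.+1) :
  size (flatten [seq comp_env (p k) | k <- enum I]) =
  \sum_k tr_dim ([ffun j => (comp_decode (p j)).1] k).
Proof.
rewrite -big_enum /=; elim: (enum I) => [|k s IH] /=; first by rewrite big_nil.
by rewrite size_cat size_coord_pieces IH big_cons ffunE.
Qed.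

Lemma bounded_flat_size (e : seq (piece M)) n (A : form T) :
  bounded (size e) A -> total_dim e = n -> bounded n (translate_flat e (unwind A)).
Proof. by move=> bA <-; apply/bounded_translate_flat/fbounded_unwind. Qed.

Lemma bounded_eq_size i j :
  bounded (size (comp_env i ++ comp_env j)) (tr_eq (comp_decode i).1 (comp_decode j).1).
Proof. by rewrite size_cat !size_coord_pieces tr_eq_bounded. Qed.

Lemma bounded_rel_size (r : rsym S) (p : {ffun 'I_(rar r) -> 'I_comp_pred_pieces.+1}) :
  bounded (size (flatten [seq comp_env (p k) | k <- enum 'I_(rar r)]))
    (tr_rel [ffun k => (comp_decode (p k)).1]).
Proof. by rewrite size_comp_envs tr_rel_bounded. Qed.

Lemma bounded_fun_size (f : fsym S) (p : {ffun 'I_(far f) -> 'I_comp_pred_pieces.+1}) i :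
  bounded (size (flatten [seq comp_env (p k) | k <- enum 'I_(far f)] ++ comp_env i))
    (tr_fun [ffun k => (comp_decode (p k)).1] (comp_decode i).1).
Proof. by rewrite size_cat size_comp_envs size_coord_pieces tr_fun_bounded. Qed.

Lemma comp_dom_bounded i : bounded (comp_dim i) (comp_dom i).
Proof.
rewrite bounded_and; apply/andP; split; last first.
  by apply: bounded_flat_size; rewrite // size_coord_pieces tr_dom_bounded.
apply: bounded_conj => x; rewrite mem_iota => lt_x.
by apply: bounded_inst; [rewrite size_block tr_dom_bounded | apply: block_bound].
Qed.

Lemma comp_eq_bounded i j : bounded (comp_dim i + comp_dim j) (comp_eq i j).
Proof. by apply: bounded_flat_size (bounded_eq_size i j) _; apply: total_dim_cat. Qed.

Lemma comp_rel_bounded (r : rsym S) (p : {ffun 'I_(rar r) -> 'I_comp_pred_pieces.+1}) :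
  bounded (\sum_k comp_dim (p k)) (comp_rel p).
Proof. by apply: bounded_flat_size (bounded_rel_size p) _; apply: total_dim_flatten. Qed.

Lemma comp_fun_bounded (f : fsym S) (p : {ffun 'I_(far f) -> 'I_comp_pred_pieces.+1}) i :
  bounded (\sum_k comp_dim (p k) + comp_dim i) (comp_fun p i).
Proof.
apply: bounded_flat_size (bounded_fun_size p i) _.
by rewrite total_dim_cat total_dim_flatten.
Qed.

Definition comp_translation : translation S R :=
  Translation comp_dom_bounded comp_eq_bounded comp_rel_bounded comp_fun_bounded.

Section Correct.
Variable X : satisfaction R.

Let F1 : flat_structure T := induced M X.
Let F2 : flat_structure S := induced K (unwound F1).
Let F3 : flat_structure S := induced comp_translation X.

Definition regroup (a : fcarrier F3) : fcarrier F2 :=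
  ((comp_decode a.1).1, chunk X (comp_env a.1) a.2).

(** Pieces of the composition that differ only in the dropped padding regroup to the same piece of
    [K], so this map need not be injective. That is why the two structures are compared by a
    bisimulation and not by an isomorphism. *)
Definition same_element (a : fcarrier F3) (b : fcarrier F2) : Prop :=
  size a.2 = comp_dim a.1 /\ b = regroup a.

(** The two conjuncts of [comp_dom] say that the coordinates lie in [M]-domains and that the
    regrouped tuple lies in the [K]-domain; membership of the entries in the domain of [X] is
    distributed over the coordinates. *)
Lemma fdom_regroup (a : fcarrier F3) : size a.2 = comp_dim a.1 ->
  fdom a <-> fdom (regroup a).
Proof.
case: a => i s /= sz; set e := comp_env i.
have szc : size (chunk X e s) = tr_dim (comp_decode i).1.
  by rewrite size_chunk size_coord_pieces.
have dom_i : sat (s := X) (nth (point X) s) (comp_dom i) <->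
    (forall x, x < size e -> sat (s := X) (nth (point X) (read X e (nth (point X) s) x).2)
                                (tr_dom (piece_of e x))) /\
    sat (s := unwound F1) (nth (fpoint F1) (chunk X e s)) (tr_dom (comp_decode i).1).
  rewrite sat_and sat_conj -sat_chunk //; last first.
    by rewrite size_coord_pieces tr_dom_bounded.
  split=> - [h1 h2]; split=> // x lt_x.
    have := h1 x; rewrite mem_iota add0n => /(_ lt_x).
    by rewrite sat_inst // size_block tr_dom_bounded.
  rewrite mem_iota add0n in lt_x; rewrite sat_inst; first exact: h1.
  by rewrite size_block tr_dom_bounded.
have in_s : all_of (@indom R X) s <->
    (forall x, x < size e -> all_of (@indom R X) (read X e (nth (point X) s) x).2).
  rewrite -(indom_chunk sz) (all_of_nth _ _ (fpoint F1)) size_chunk.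
  by split=> h x lt_x; have := h x lt_x; rewrite nth_chunk.
have in_c : all_of (@fdom T F1) (chunk X e s) <->
    (forall x, x < size e -> fdom (read X e (nth (point X) s) x)).
  rewrite (all_of_nth _ _ (fpoint F1)) size_chunk.
  by split=> h x lt_x; have := h x lt_x; rewrite nth_chunk.
split=> - [_ /= h1].
  move=> /dom_i[h2 h3]; split=> //=; apply/in_c => x lt_x.
  split; [|exact: (proj1 in_s h1)|exact: h2].
  by rewrite /= size_map size_block.
move=> h2; split=> //=; first by apply/in_s => x lt_x; have [] := proj1 in_c h1 x lt_x.
apply/dom_i; split=> // x lt_x.
by have [] := proj1 in_c h1 x lt_x.
Qed.

Lemma same_element_back b : fdom b -> exists2 a : fcarrier F3, fdom a & same_element a b.
Proof.
case: b => j c dom_b; have [/= szc dom_c _] := dom_b.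
have le_c : size (map fst c) <= max_dim by rewrite size_map szc; apply: leq_bigmax.
(* The pieces of the coordinates are padded with piece 0 to length [max_dim]; [coord_pieces] cuts
   the padding off again. *)
have sz_pad : size (map fst c ++ nseq (max_dim - size c) ord0) == max_dim.
  by rewrite size_cat size_nseq size_map subnKC // -(size_map fst).
have [i def_i] := comp_decode_surj (j, Tuple sz_pad).
have env_i : comp_env i = map fst c.
  by rewrite /comp_env def_i /coord_pieces /= take_size_cat // size_map.
pose a : fcarrier F3 := (i, flatten (map snd c)).
have sz_a : size a.2 = comp_dim a.1.
  by rewrite /= /comp_dim env_i size_flatten_snd.
have def_b : (j, c) = regroup a.
  by rewrite /regroup /= def_i env_i chunkK.
by exists a => //; apply/(fdom_regroup sz_a); rewrite -def_b.
Qed.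

Lemma same_element_forth a : fdom a -> exists2 b : fcarrier F2, fdom b & same_element a b.
Proof.
move=> dom_a; have [/= sz_a _ _] := dom_a.
by exists (regroup a) => //; apply/fdom_regroup.
Qed.

Lemma chunk_family (I : finType) (a : I -> fcarrier F3) (b : I -> fcarrier F2) :
  (forall k, same_element (a k) (b k)) ->
  [/\ size (flatten [seq (a k).2 | k <- enum I]) =
        total_dim (flatten [seq comp_env (a k).1 | k <- enum I]),
      flatten [seq (b k).2 | k <- enum I] =
        chunk X (flatten [seq comp_env (a k).1 | k <- enum I])
                (flatten [seq (a k).2 | k <- enum I]) &
      (fun k => (b k).1) =1 (fun k => (comp_decode (a k).1).1)].
Proof.
move=> Rab; split=> [||k]; last by case: (Rab k) => _ ->.
  elim: (enum I) => //= k s IH; rewrite size_cat total_dim_cat IH.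
  by case: (Rab k) => ->.
rewrite chunk_flatten => [|k]; last by case: (Rab k).
by congr flatten; apply: eq_map => k; case: (Rab k) => _ ->.
Qed.

Lemma sat_comp (A : form S) rho : bounded 0 A ->
  sat (s := X) rho (translate comp_translation A) <->
  sat (s := X) rho (translate M (translate K A)).
Proof.
move=> bA; rewrite /translate.
rewrite (sat_translate_flat (K := comp_translation)).
rewrite (sat_translate_flat (K := M)).
(* By definition this is satisfaction in [unwound F1], to which the translation lemma applies a
   second time, now for [K]. *)
rewrite -[fsat _ (unwind (translate_flat _ _))]/(sat (s := unwound F1) (read X [::] rho)
  (translate_flat (K := K) [::] (unwind A))).
rewrite sat_translate_flat.
apply: (fsat_bisim (R := same_element)) (fbounded_unwind bA) _ => //.
- move=> a a' b b' [sz_a ->] [sz_b ->]; rewrite /= /comp_eq.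
  rewrite sat_chunk; [|by rewrite size_cat sz_a sz_b total_dim_cat|exact: bounded_eq_size].
  by rewrite chunk_cat.
- move=> r as_ as' /chunk_family[sz eq_chunk eq_1]; rewrite /= /comp_rel.
  have -> : [ffun k => (as' k).1] =
      [ffun k => (comp_decode ([ffun k0 => (as_ k0).1] k)).1].
    by apply/ffunP => k; rewrite !ffunE eq_1.
  have env_eq : [seq comp_env ([ffun k0 => (as_ k0).1] k) | k <- enum 'I_(rar r)] =
      [seq comp_env (as_ k).1 | k <- enum 'I_(rar r)].
    by apply: eq_map => k; rewrite ffunE.
  have := bounded_rel_size [ffun k0 => (as_ k0).1]; rewrite eq_chunk env_eq => bR.
  by rewrite sat_chunk.
- move=> f as_ as' b b' /chunk_family[sz eq_chunk eq_1] [sz_b ->]; rewrite /= /comp_fun.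
  have -> : [ffun k => (as' k).1] =
      [ffun k => (comp_decode ([ffun k0 => (as_ k0).1] k)).1].
    by apply/ffunP => k; rewrite !ffunE eq_1.
  have env_eq : [seq comp_env ([ffun k0 => (as_ k0).1] k) | k <- enum 'I_(far f)] =
      [seq comp_env (as_ k).1 | k <- enum 'I_(far f)].
    by apply: eq_map => k; rewrite ffunE.
  have := bounded_fun_size [ffun k0 => (as_ k0).1] b.1; rewrite eq_chunk env_eq => bR.
  rewrite sat_chunk //; last by rewrite size_cat sz sz_b total_dim_cat.
  by rewrite chunk_cat.
- exact: same_element_forth.
- exact: same_element_back.
Qed.

End Correct.
End Composition.

(** * Added axioms and the transfer of interpreters *)

Definition sentence_imp S (B A : sentence S) : sentence S :=
  exist (fun A => is_true (bounded 0 A)) (Imp (sval B) (sval A))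
    (introT andP (conj (valP B) (valP A))).

Definition sentence_translate S T (K : translation S T) (A : sentence S) : sentence T :=
  exist (fun A => is_true (bounded 0 A)) (translate K (sval A))
    (bounded_translate K (valP A)).

Lemma proves_add_axiom (U : theory) (B : sentence (sig U)) A :
  proves (T := add_axiom B) A <-> proves (T := U) (Imp (sval B) A).
Proof.
split=> [p|/prv_deduct p]; first apply: prv_impI; apply: prv_mono p => C.
  by case=> D [aD|->] ->; [left; exists D|right].
by case=> [[D aD ->]|->]; [exists D => //; left|exists B => //; right].
Qed.

(** The translation of a sentence is a sentence, so soundness of [K] and then of [M] yields the
    iterated translation; [sat_comp] replaces it by the composed one. *)
Lemma interprets_trans (W T D : theory) :
  interprets W T -> interprets T D -> interprets W D.
Proof.
move=> [M] [K]; exists; exists (comp_translation K M) => A pA.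
apply: proves_of_sat (_ : proves (translate M (translate K (sval A)))).
  by move=> X rho h; apply/(sat_comp K M rho (valP A)).
exact: (itr_sound M (A := sentence_translate K A)) (itr_sound K pA).
Qed.

(** The translation is unchanged. The added axiom moves into an implication, and translation
    commutes with implication by computation. *)
Lemma interprets_add_axiom (U V : theory) (K : interpretation V U)
    (B : sentence (sig V)) (C : sentence (sig U)) :
  proves (T := U) (Imp (sval C) (translate K (sval B))) ->
  interprets (add_axiom C) (add_axiom B).
Proof.
move=> pCB; exists; exists (itr K : translation (sig (add_axiom B)) (sig (add_axiom C))).
move=> A /proves_add_axiom pBA; apply/proves_add_axiom.
exact: prv_trans pCB (itr_sound K (A := sentence_imp B A) pBA).
Qed.

Lemma interpreter_translate (U V : theory) (K : interpretation V U)
    (M : interpretation U V) (A : fin_theory) (C : sentence (sig U)) :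
  (forall B : sentence (sig V),
     proves (T := V) (Iff (translate M (translate K (sval B))) (sval B))) ->
  is_interpreter A C -> is_interpreter A (sentence_translate M C).
Proof.
move=> KM intC B; split=> [intA|/proves_add_axiom pBC]; last first.
  apply: interprets_trans (interprets_add_axiom pBC) _; apply/intC.
  by apply/proves_add_axiom/prv_impI/prv_ax; right.
have pBK : proves (T := U) (Imp (translate K (sval B)) (translate K (sval B))).
  by apply/prv_impI/prv_ax; right.
(* [K] itself interprets [V+B] in [U+B^K], which reduces the claim to the given interpretation of
   [A] in [V+B]. *)
have intU : interprets (add_axiom (sentence_translate K B)) (add_axiom B).
  exact: (interprets_add_axiom (C := sentence_translate K B) pBK).
have /intC/proves_add_axiom pKC := interprets_trans intU intA.
apply/proves_add_axiom; apply: prv_trans (prv_iffr (KM B)) _.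
exact: (itr_sound M (A := sentence_imp (sentence_translate K B) C)).
Qed.

(** * Recursive functions *)

Section RecursiveFunctions.

Lemma recursive_nth n i : i < n -> @recursive n (fun x => nth 0 x i).
Proof.
by move=> lt_i; apply: rec_ext (rec_proj (Ordinal lt_i)) => x; rewrite (tnth_nth 0).
Qed.

Lemma recursive_comp1 n (f : nat -> nat) (g : n.-tuple nat -> nat) :
  recursive1 f -> recursive g -> recursive (fun x => f (g x)).
Proof.
move=> rf rg; apply: rec_ext (rec_comp rf (fun _ => rg)) => x.
by rewrite /thead tnth_mktuple.
Qed.

Definition recursive2 (f : nat -> nat -> nat) : Prop :=
  @recursive 2 (fun x => f (nth 0 x 0) (nth 0 x 1)).

Definition recursive3 (f : nat -> nat -> nat -> nat) : Prop :=
  @recursive 3 (fun x => f (nth 0 x 0) (nth 0 x 1) (nth 0 x 2)).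

Lemma recursive_comp2 n f (g h : n.-tuple nat -> nat) :
  recursive2 f -> recursive g -> recursive h -> recursive (fun x => f (g x) (h x)).
Proof.
move=> rf rg rh; pose gs (i : 'I_2) := if val i == 0 then g else h.
have rgs i : recursive (gs i) by rewrite /gs; case: ifP.
apply: rec_ext (rec_comp rf rgs) => x.
by rewrite (nth_mktuple _ _ (@ord0 1)) (nth_mktuple _ _ (@ord_max 1)).
Qed.

Lemma recursive_nat_rec (f : nat -> nat) (g : nat -> nat -> nat -> nat)
    (h : nat -> nat -> nat) :
  recursive1 f -> recursive3 g -> (forall x, h 0 x = f x) ->
  (forall k x, h k.+1 x = g k (h k x) x) -> recursive2 h.
Proof.
move=> rf rg h0 hS; apply: rec_prim rf rg _ _ => [x|k x] /=; rewrite ?h0 ?hS //.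
by rewrite /thead (tnth_nth 0).
Qed.

Lemma recursive_cst n c : @recursive n (fun=> c).
Proof.
elim: c => [|c IH]; last exact: recursive_comp1 rec_succ IH.
(* The nullary zero becomes n-ary by composition with an empty family. *)
have r0 (i : 'I_0) : @recursive n (fun=> 0) by case: i.
exact: rec_ext (rec_comp rec_zero r0).
Qed.

Lemma recursive1E (f : nat -> nat) :
  @recursive 1 (fun x => f (nth 0 x 0)) -> recursive1 f.
Proof. by apply: rec_ext => x; rewrite /thead (tnth_nth 0). Qed.

Lemma recursive1_id : recursive1 id.
Proof. exact/recursive1E/recursive_nth. Qed.

Lemma recursive1_comp f g : recursive1 f -> recursive1 g -> recursive1 (fun x => f (g x)).
Proof. exact: recursive_comp1. Qed.

Lemma recursive1_comp2 f g h :
  recursive2 f -> recursive1 g -> recursive1 h -> recursive1 (fun x => f (g x) (h x)).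
Proof. exact: recursive_comp2. Qed.

Lemma recursive_pred : recursive1 predn.
Proof.
have rp : recursive2 (fun k _ => k.-1).
  by apply: (@recursive_nat_rec (fun=> 0) (fun k _ _ => k)) => //;
    [apply: recursive_cst | apply: recursive_nth].
exact: (@recursive1_comp2 _ id (fun=> 0)) rp recursive1_id (recursive_cst _ 0).
Qed.

Lemma recursive_add : recursive2 addn.
Proof.
apply: (@recursive_nat_rec id (fun _ r _ => r.+1)) => //; first exact: recursive1_id.
by apply: recursive_comp1 rec_succ _; apply: recursive_nth.
Qed.

Lemma recursive_sub : recursive2 subn.
Proof.
(* Recursion runs on the first argument, so the subtrahend is put there. *)
have rs : recursive2 (fun k x => x - k).
  apply: (@recursive_nat_rec id (fun _ r _ => r.-1)) => [|||k x].
  - exact: recursive1_id.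
  - by apply: recursive_comp1 recursive_pred _; apply: recursive_nth.
  - exact: subn0.
  - exact: subnS.
by apply: recursive_comp2 rs _ _; apply: recursive_nth.
Qed.

Fixpoint triangle (n : nat) : nat := if n is n'.+1 then n'.+1 + triangle n' else 0.

(** [triangle] copies the recursion inside [Cantor.to_nat], whence the proof by computation. *)
Lemma pair_codeE x y : pair_code x y = y + triangle (y + x).
Proof. by []. Qed.

Lemma recursive1_nat_rec (g : nat -> nat -> nat) (h : nat -> nat) :
  recursive2 g -> (forall k, h k.+1 = g k (h k)) -> recursive1 h.
Proof.
move=> rg hS; have rh : recursive2 (fun k _ => h k).
  apply: (@recursive_nat_rec (fun=> h 0) (fun k r _ => g k r)) => //.
    exact: recursive_cst.
  by apply: recursive_comp2 rg _ _; apply: recursive_nth.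
exact: (@recursive1_comp2 _ id (fun=> 0)) rh recursive1_id (recursive_cst _ 0).
Qed.

Lemma recursive_triangle : recursive1 triangle.
Proof.
apply: (@recursive1_nat_rec (fun k r => k.+1 + r)) => //.
apply: recursive_comp2 recursive_add _ _; last exact: recursive_nth.
by apply: recursive_comp1 rec_succ _; apply: recursive_nth.
Qed.

Lemma recursive_pair : recursive2 pair_code.
Proof.
apply: (@recursive_comp2 2 addn) recursive_add _ _; first exact: recursive_nth.
apply: recursive_comp1 recursive_triangle _.
by apply: recursive_comp2 recursive_add _ _; apply: recursive_nth.
Qed.

(* The largest w such that triangle w <= n, i.e. the antidiagonal of n. *)
Fixpoint diagonal (n : nat) : nat :=
  if n is n'.+1 then diagonal n' + (1 - (triangle (diagonal n').+1 - n)) else 0.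

Lemma recursive_diagonal : recursive1 diagonal.
Proof.
apply: (@recursive1_nat_rec (fun k r => r + (1 - (triangle r.+1 - k.+1)))) => //.
apply: recursive_comp2 recursive_add _ _; first exact: recursive_nth.
apply: recursive_comp2 recursive_sub (recursive_cst _ 1) _.
apply: recursive_comp2 recursive_sub _ _.
  apply: recursive_comp1 recursive_triangle _.
  by apply: recursive_comp1 rec_succ _; apply: recursive_nth.
by apply: recursive_comp1 rec_succ _; apply: recursive_nth.
Qed.

Lemma diagonal_bounds n : triangle (diagonal n) <= n < triangle (diagonal n).+1.
Proof.
elim: n => // n /=; set w := diagonal n; set t := triangle w.
case: (leqP (w.+1 + t) n.+1) => le_w.
  by rewrite (eqP le_w) subn0 addn1 /= -/t; lia.
have -> : 1 - (w.+1 + t - n.+1) = 0 by lia.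
by rewrite addn0 -/t; lia.
Qed.

Lemma leq_triangle m n : m <= n -> triangle m <= triangle n.
Proof. by move/subnK <-; elim: (n - m) => //= k IH; lia. Qed.

(** Both numbers place the code between the same kind of consecutive triangular numbers, and
    [triangle] is monotone. *)
Lemma diagonal_pair x y : diagonal (pair_code x y) = y + x.
Proof.
have := diagonal_bounds (pair_code x y); rewrite pair_codeE.
set w := diagonal _; case: (ltngtP w (y + x)) => // /leq_triangle /=; lia.
Qed.

Definition unpair1 (n : nat) : nat := diagonal n - (n - triangle (diagonal n)).
Definition unpair2 (n : nat) : nat := n - triangle (diagonal n).

Lemma unpair2_pair x y : unpair2 (pair_code x y) = y.
Proof. by rewrite /unpair2 diagonal_pair pair_codeE addnK. Qed.

Lemma unpair1_pair x y : unpair1 (pair_code x y) = x.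
Proof. by rewrite /unpair1 -/(unpair2 _) unpair2_pair diagonal_pair addKn. Qed.

Lemma recursive_unpair2 : recursive1 unpair2.
Proof.
apply: recursive1_comp2 recursive_sub recursive1_id _.
exact: recursive1_comp recursive_triangle recursive_diagonal.
Qed.

Lemma recursive_unpair1 : recursive1 unpair1.
Proof. exact: recursive1_comp2 recursive_sub recursive_diagonal recursive_unpair2. Qed.

Lemma recursive_iter f : recursive1 f -> recursive2 (fun k x => iter k f x).
Proof.
move=> rf; apply: (@recursive_nat_rec id (fun _ r _ => f r)) => //.
  exact: recursive1_id.
by apply: recursive_comp1 rf _; apply: recursive_nth.
Qed.

(** Branching by iteration: the step copies the first component of a pair over the second. Started
    at the pair of [f x] and [g x], zero steps leave [g x] in second place and any positive number
    of steps puts [f x] there. *)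
Lemma recursive_if (c f g : nat -> nat) :
  recursive1 c -> recursive1 f -> recursive1 g ->
  recursive1 (fun x => if c x is 0 then g x else f x).
Proof.
move=> rc rf rg; pose step p := pair_code (unpair1 p) (unpair1 p).
have rstep : recursive1 step.
  exact: recursive1_comp2 recursive_pair recursive_unpair1 recursive_unpair1.
apply: rec_ext (_ : recursive1 (fun x => unpair2 (iter (c x) step (pair_code (f x) (g x))))).
  move=> x /=; case: (c _) => [|n]; first exact: unpair2_pair.
  rewrite iterS {1}/step unpair2_pair.
  by elim: n => [|n IH] /=; rewrite unpair1_pair.
apply: recursive1_comp recursive_unpair2 _.
apply: recursive1_comp2 (recursive_iter rstep) rc _.
exact: recursive1_comp2 recursive_pair rf rg.
Qed.

End RecursiveFunctions.

(** * Computable functions on coded types *)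

Class Code (T : Type) := code : T -> nat.

#[global] Instance Code_nat : Code nat := id.
#[global] Instance Code_bool : Code bool := nat_of_bool.
#[global] Instance Code_ord n : Code 'I_n := @nat_of_ord n.
#[global] Instance Code_prod A B `{Code A} `{Code B} : Code (A * B) :=
  fun p => pair_code (code p.1) (code p.2).
#[global] Instance Code_seq A `{Code A} : Code (seq A) := fun s => seq_code (map code s).
#[global] Instance Code_ffun n A `{Code A} : Code {ffun 'I_n -> A} :=
  fun f => seq_code [seq code (f k) | k <- enum 'I_n].

(** The recursive function is constrained on codes only and may do anything elsewhere, so codes
    never have to be recognised. *)
Definition computable A B `{Code A} `{Code B} (f : A -> B) : Prop :=
  exists2 g, recursive1 g & forall a, g (code a) = code (f a).

Section Basic.
Context {X A B C : Type} `{Code X} `{Code A} `{Code B} `{Code C}.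

Lemma computable_ext (f g : A -> B) : f =1 g -> computable f -> computable g.
Proof. by move=> eq_fg [h rh hE]; exists h => // a; rewrite hE eq_fg. Qed.

Lemma computable_id : computable (fun a : A => a).
Proof. by exists id => //; apply: recursive1_id. Qed.

Lemma computable_cst (b : B) : computable (fun _ : A => b).
Proof. by exists (fun=> code b) => //; apply: recursive_cst. Qed.

Lemma computable_comp (f : B -> C) (g : A -> B) :
  computable f -> computable g -> computable (fun x => f (g x)).
Proof.
move=> [h rh hE] [k rk kE]; exists (fun x => h (k x)).
  exact: recursive1_comp.
by move=> a; rewrite kE hE.
Qed.

Lemma computable_pair (f : X -> A) (g : X -> B) :
  computable f -> computable g -> computable (fun x => (f x, g x)).
Proof.
move=> [h rh hE] [k rk kE]; exists (fun x => pair_code (h x) (k x)).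
  exact: recursive1_comp2 recursive_pair rh rk.
by move=> a; rewrite hE kE.
Qed.

End Basic.

Section Functions.
Context {X A B C : Type} `{Code X} `{Code A} `{Code B} `{Code C}.

Lemma computable_fst (f : X -> A * B) : computable f -> computable (fun x => (f x).1).
Proof.
apply: (computable_comp (f := fst)); exists unpair1; first exact: recursive_unpair1.
by case=> a b; apply: unpair1_pair.
Qed.

Lemma computable_snd (f : X -> A * B) : computable f -> computable (fun x => (f x).2).
Proof.
apply: (computable_comp (f := snd)); exists unpair2; first exact: recursive_unpair2.
by case=> a b; apply: unpair2_pair.
Qed.

Lemma computable_code (f : X -> A) : computable f -> computable (fun x => code (f x) : nat).
Proof. by case=> h rh hE; exists h. Qed.

Lemma computable_nat2 (F : nat -> nat -> nat) (f g : X -> nat) :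
  recursive2 F -> computable f -> computable g -> computable (fun x => F (f x) (g x)).
Proof.
move=> rF [h rh hE] [k rk kE]; exists (fun x => F (h x) (k x)).
  exact: recursive1_comp2.
by move=> a; rewrite hE kE.
Qed.

Lemma computable_succ (f : X -> nat) : computable f -> computable (fun x => (f x).+1).
Proof.
case=> h rh hE; exists (fun x => (h x).+1) => [|a]; last by rewrite hE.
exact: recursive_comp1 rec_succ rh.
Qed.

Lemma computable_pred (f : X -> nat) : computable f -> computable (fun x => (f x).-1).
Proof.
case=> h rh hE; exists (fun x => (h x).-1) => [|a]; last by rewrite hE.
exact: recursive_comp1 recursive_pred rh.
Qed.

Lemma computable_add (f g : X -> nat) :
  computable f -> computable g -> computable (fun x => f x + g x).
Proof. by move=> cf cg; apply: (computable_nat2 recursive_add). Qed.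

Lemma computable_sub (f g : X -> nat) :
  computable f -> computable g -> computable (fun x => f x - g x).
Proof. by move=> cf cg; apply: (computable_nat2 recursive_sub). Qed.

Lemma computable_if (b : X -> bool) (f g : X -> A) :
  computable b -> computable f -> computable g ->
  computable (fun x => if b x then f x else g x).
Proof.
move=> [c rc cE] [h rh hE] [k rk kE].
exists (fun x => if c x is 0 then k x else h x); first exact: recursive_if.
by move=> a; rewrite cE hE kE; case: (b a).
Qed.

(** The parameter travels inside the iterated state, next to the value. *)
Lemma computable_iter (step : X * A -> A) (n : X -> nat) (f : X -> A) :
  computable step -> computable n -> computable f ->
  computable (fun x => iter (n x) (fun a => step (x, a)) (f x)).
Proof.
move=> [s rs sE] [m rm mE] [h rh hE].
pose st p := pair_code (unpair1 p) (s p).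
have rst : recursive1 st by apply: recursive1_comp2 recursive_pair recursive_unpair1 rs.
exists (fun x => unpair2 (iter (m x) st (pair_code x (h x)))).
  apply: recursive1_comp recursive_unpair2 _.
  apply: recursive1_comp2 (recursive_iter rst) rm _.
  exact: recursive1_comp2 recursive_pair recursive1_id rh.
move=> x; rewrite mE hE.
have iterE k : iter k st (pair_code (code x) (code (f x))) =
    pair_code (code x) (code (iter k (fun a => step (x, a)) (f x))).
  elim: k => [|k IH] //=; rewrite IH /st unpair1_pair.
  by have -> := sE (x, iter k (fun a => step (x, a)) (f x)).
by rewrite iterE unpair2_pair.
Qed.

End Functions.

Lemma computable_leq X `{Code X} (f g : X -> nat) :
  computable f -> computable g -> computable (fun x => f x <= g x).
Proof.
move=> cf cg; case: (computable_sub cf cg) => h rh hE.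
exists (fun x => if h x is 0 then 1 else 0).
  exact: recursive_if rh (recursive_cst _ 0) (recursive_cst _ 1).
by move=> a; rewrite hE -subn_eq0; case: (f a - g a).
Qed.

Section Lists.
Context {X A B : Type} `{Code X} `{Code A} `{Code B}.

Lemma computable_cons (f : X -> A) (s : X -> seq A) :
  computable f -> computable s -> computable (fun x => f x :: s x).
Proof.
move=> [h rh hE] [k rk kE]; exists (fun x => (pair_code (h x) (k x)).+1).
  exact: recursive_comp1 rec_succ (recursive1_comp2 recursive_pair rh rk).
by move=> a; rewrite hE kE.
Qed.

Lemma computable_case_seq (s : X -> seq A) (n : X -> B) (c : X * (A * seq A) -> B) :
  computable s -> computable n -> computable c ->
  computable (fun x => if s x is a :: s' then c (x, (a, s')) else n x).
Proof.
move=> [h rh hE] [m rm mE] [k rk kE].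
exists (fun x => if h x is 0 then m x else k (pair_code x (h x).-1)).
  apply: (recursive_if rh _ rm); apply: recursive1_comp rk _.
  apply: recursive1_comp2 recursive_pair recursive1_id _.
  exact: recursive1_comp recursive_pred rh.
move=> x; rewrite hE mE; case: (s x) => // a s'.
exact: kE (x, (a, s')).
Qed.

Lemma leq_pair1 x y : x <= pair_code x y.
Proof.
rewrite pair_codeE; suff leq_tri n : n <= triangle n by have := leq_tri (y + x); lia.
by case: n => //= n; lia.
Qed.

Lemma leq_pair2 x y : y <= pair_code x y.
Proof. by rewrite pair_codeE leq_addr. Qed.

(** Supplies a computable number of iterations for folds. *)
Lemma leq_size_code (s : seq A) : size s <= code s.
Proof.
elim: s => //= a s IH; apply: leq_ltn_trans IH _.
by rewrite ltnS; apply: leq_pair2.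
Qed.

End Lists.

Ltac computable_step :=
  match goal with
  | H : computable ?f |- computable ?f => exact H
  | |- computable (fun _ => ?c) => apply (computable_cst c)
  | |- computable (fun x => x) => apply computable_id
  | |- computable (fun x => (@?f x, @?g x)) => apply (computable_pair (f := f) (g := g))
  | |- computable (fun x => (@?f x).1) => apply (computable_fst (f := f))
  | |- computable (fun x => (@?f x).2) => apply (computable_snd (f := f))
  | |- computable fst => apply (computable_fst (f := id))
  | |- computable snd => apply (computable_snd (f := id))
  | |- computable (fun x => @?f x :: @?s x) => apply (computable_cons (f := f) (s := s))
  | |- computable (fun x => (@?f x).+1) => apply (computable_succ (f := f))
  | |- computable (fun x => (@?f x).-1) => apply (computable_pred (f := f))
  | |- computable (fun x => @?f x + @?g x) => apply (computable_add (f := f) (g := g))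
  | |- computable (fun x => @?f x - @?g x) => apply (computable_sub (f := f) (g := g))
  | |- computable (fun x => @?f x <= @?g x) => apply (computable_leq (f := f) (g := g))
  end.

Ltac computability := repeat computable_step.

(** The state holds the accumulator and the rest of the list. An empty rest leaves the state fixed,
    so iterating more often than the length of the list does no harm. *)
Lemma computable_foldl X A B `{Code X} `{Code A} `{Code B}
    (step : X * (B * A) -> B) (b : X -> B) (s : X -> seq A) :
  computable step -> computable b -> computable s ->
  computable (fun x => foldl (fun b a => step (x, (b, a))) (b x) (s x)).
Proof.
move=> cstep cb cs.
pose st (p : X * (B * seq A)) : B * seq A :=
  if p.2.2 is a :: s' then (step (p.1, (p.2.1, a)), s') else p.2.
apply: (computable_ext (f := fun x =>
    (iter (code (s x)) (fun p => st (x, p)) (b x, s x)).1)).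
  move=> x; suff -> : forall n t c, size t <= n ->
      iter n (fun p => st (x, p)) (c, t) = (foldl (fun b a => step (x, (b, a))) c t, [::]).
  - by [].
  - exact: leq_size_code.
  by elim=> [|n IH] [|a t] c lt_n //; rewrite iterSr IH.
apply: computable_fst; apply: (computable_iter (step := st)).
- apply: (computable_case_seq (s := fun p => p.2.2)
    (c := fun q => (step (q.1.1, (q.1.2.1, q.2.1)), q.2.2))); computability.
  by apply: (computable_comp (f := step)); computability.
- exact: computable_code.
- by computability.
Qed.

Lemma computable_rev X A `{Code X} `{Code A} (s : X -> seq A) :
  computable s -> computable (fun x => rev (s x)).
Proof.
move=> cs; apply: (computable_ext (f := fun x => foldl (fun t a => a :: t) [::] (s x))).
  by move=> x; rewrite /rev; elim: (s x) [::] => //= a t IH u; rewrite IH.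
apply: (computable_foldl (step := fun q => q.2.2 :: q.2.1)); computability.
Qed.

Lemma computable_foldr X A B `{Code X} `{Code A} `{Code B}
    (step : X * (A * B) -> B) (b : X -> B) (s : X -> seq A) :
  computable step -> computable b -> computable s ->
  computable (fun x => foldr (fun a b => step (x, (a, b))) (b x) (s x)).
Proof.
move=> cstep cb cs.
apply: (computable_ext (f := fun x =>
   foldl (fun b a => step (x, (a, b))) (b x) (rev (s x)))).
  by move=> x; rewrite foldl_rev.
apply: (computable_foldl (step := fun q => step (q.1, (q.2.2, q.2.1)))) => //.
  by apply: (computable_comp (f := step)); computability.
exact: computable_rev.
Qed.

Lemma computable_map X A B `{Code X} `{Code A} `{Code B}
    (F : X * A -> B) (s : X -> seq A) :
  computable F -> computable s -> computable (fun x => [seq F (x, a) | a <- s x]).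
Proof.
move=> cF cs; apply: (computable_foldr (step := fun q => F (q.1, q.2.1) :: q.2.2)); computability.
by apply: (computable_comp (f := F)); computability.
Qed.

Lemma computable_cat X A `{Code X} `{Code A} (s t : X -> seq A) :
  computable s -> computable t -> computable (fun x => s x ++ t x).
Proof.
move=> cs ct; apply: (computable_ext (f := fun x => foldr cons (t x) (s x))).
  by move=> x; elim: (s x) => //= a u ->.
apply: (computable_foldr (step := fun q => q.2.1 :: q.2.2)); computability.
Qed.

Lemma computable_flatten X A `{Code X} `{Code A} (s : X -> seq (seq A)) :
  computable s -> computable (fun x => flatten (s x)).
Proof.
move=> cs; apply: (computable_foldr (step := fun q => q.2.1 ++ q.2.2)); computability.
by apply: computable_cat; computability.
Qed.

Lemma computable_size X A `{Code X} `{Code A} (s : X -> seq A) :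
  computable s -> computable (fun x => size (s x)).
Proof.
move=> cs; apply: (computable_ext (f := fun x => foldr (fun _ n => n.+1) 0 (s x))).
  by move=> x; elim: (s x) => //= a u ->.
apply: (computable_foldr (step := fun q => q.2.2.+1)); computability.
Qed.

Lemma computable_sumn X `{Code X} (s : X -> seq nat) :
  computable s -> computable (fun x => sumn (s x)).
Proof.
move=> cs; apply: (computable_foldr (step := fun q => q.2.1 + q.2.2)); computability.
Qed.

Lemma computable_all X A `{Code X} `{Code A} (p : A -> bool) (s : X -> seq A) :
  computable p -> computable s -> computable (fun x => all p (s x)).
Proof.
move=> cp cs; apply: (computable_ext (f := fun x =>
    foldr (fun a b => if p a then b else false) true (s x))).
  by move=> x; elim: (s x) => //= a u ->; case: (p a).
apply: (computable_foldr (step := fun q => if p q.2.1 then q.2.2 else false)); computability.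
apply: computable_if; computability.
by apply: (computable_comp (f := p)); computability.
Qed.

Lemma computable_rcons X A `{Code X} `{Code A} (s : X -> seq A) (f : X -> A) :
  computable s -> computable f -> computable (fun x => rcons (s x) (f x)).
Proof.
move=> cs cf; apply: (computable_ext (f := fun x => s x ++ [:: f x])).
  by move=> x; rewrite cats1.
by apply: computable_cat; computability.
Qed.

Lemma computable_drop X A `{Code X} `{Code A} (n : X -> nat) (s : X -> seq A) :
  computable n -> computable s -> computable (fun x => drop (n x) (s x)).
Proof.
move=> cn cs; apply: (computable_ext (f := fun x => iter (n x) behead (s x))).
  move=> x; elim: (n x) (s x) => [|k IH] t; first by rewrite drop0.
  by rewrite iterSr IH; case: t.
apply: (computable_iter (step := fun q => behead q.2)) => //.
apply: (computable_ext (f := fun q : X * seq A => if q.2 is a :: t then t else [::])).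
  by move=> [x [|a t]].
by apply: (computable_case_seq (s := snd) (c := fun q => q.2.2)); computability.
Qed.

Lemma computable_nth X A `{Code X} `{Code A} (d : A) (s : X -> seq A) (n : X -> nat) :
  computable s -> computable n -> computable (fun x => nth d (s x) (n x)).
Proof.
move=> cs cn; apply: (computable_ext (f := fun x =>
    if drop (n x) (s x) is a :: t then a else d)).
  by move=> x; elim: (n x) (s x) => [|k IH] [|a t] //=; rewrite ?drop0.
apply: (computable_case_seq (s := fun x => drop (n x) (s x)) (c := fun q => q.2.1)); computability.
exact: computable_drop.
Qed.

Lemma computable_iota X `{Code X} (m n : X -> nat) :
  computable m -> computable n -> computable (fun x => iota (m x) (n x)).
Proof.
move=> cm cn; apply: (computable_ext (f := fun x =>
    iter (n x) (fun s => rcons s (m x + size s)) [::])).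
  move=> x; elim: (n x) => // k IH; rewrite iterS IH size_iota.
  by rewrite -addn1 iotaD cats1.
apply: (computable_iter (step := fun q => rcons q.2 (m q.1 + size q.2))); computability.
apply: computable_rcons; computability; last by apply: computable_size; computability.
by apply: (computable_comp (f := m)); computability.
Qed.

Lemma computable_take X A `{Code X} `{Code A} (n : X -> nat) (s : X -> seq A) :
  computable n -> computable s -> computable (fun x => take (n x) (s x)).
Proof.
move=> cn cs; apply: (computable_ext (f := fun x =>
    rev (drop (size (s x) - n x) (rev (s x))))).
  by move=> x; rewrite -[in RHS](revK (s x)) take_rev size_rev.
apply: computable_rev; apply: computable_drop; last exact: computable_rev.
by computability; apply: computable_size.
Qed.

(** The list [r] is fixed while [x] varies: the result is written out entry by entry, and each index
    may come with its own recursive function. *)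
Lemma computable_mkseq X A `{Code X} `{Code A} (I : Type) (F : I -> X -> A) (r : seq I) :
  (forall i, computable (F i)) -> computable (fun x => [seq F i x | i <- r]).
Proof. by move=> cF; elim: r => [|i r IH] /=; computability. Qed.

Section Recursion.
Context {X Y : Type} `{Code X} `{Code Y}.
Variables (f : X -> Y) (m : X -> nat) (D : X -> seq X) (G : X * seq Y -> Y).
Hypotheses (cm : computable m) (cD : computable D) (cG : computable G).
Hypothesis mD : forall x y, List.In y (D x) -> m y < m x.
Hypothesis fE : forall x, f x = G (x, map f (D x)).

(* The calls are unfolded level by level; level (m x).+1 is empty, and the
   values are then computed from the last level up.  Every quantity involved is
   obtained by bounded iteration, so that no course-of-values table is needed. *)
Let calls (s : seq X) : seq X := flatten (map D s).
Let level (k : nat) (x : X) : seq X := iter k calls [:: x].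

Let consume (p : seq Y * seq Y) (x : X) : seq Y * seq Y :=
  (drop (size (D x)) p.1, rcons p.2 (G (x, take (size (D x)) p.1))).

(** The first component of the state holds the values of the next level that are still unread, in
    the order of [calls]; each [x] takes exactly as many of them as it has calls. *)
Lemma foldl_consume s r acc :
  foldl consume (map f (calls s) ++ r, acc) s = (r, acc ++ map f s).
Proof.
elim: s r acc => [|x s IH] r acc /=; first by rewrite cats0.
rewrite /consume /calls /= map_cat -catA drop_size_cat ?size_map //.
by rewrite take_size_cat ?size_map // -fE IH cat_rcons.
Qed.

Lemma in_calls y s : List.In y (calls s) -> exists2 x, List.In x s & List.In y (D x).
Proof.
elim: s => //= x s IH inD; case: (List.in_app_or (D x) (calls s) y inD) => [|/IH[z]].
  by exists x; [left|].
by exists z; [right|].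
Qed.

(** Each call lowers the measure by at least one, so measure plus level never exceeds [m x]. *)
Lemma level_empty x : level (m x).+1 x = [::].
Proof.
have mlevel k y : List.In y (level k x) -> m y + k <= m x.
  elim: k y => [|k IH] y /=; first by rewrite addn0 => - [->|].
  by case/in_calls=> z /IH le_z /mD; lia.
case E: (level _ x) => [|y s] //; have := mlevel (m x).+1 y.
by rewrite E => /(_ (or_introl erefl)); lia.
Qed.

Let ascend (q : X * (nat * seq Y)) : nat * seq Y :=
  (q.2.1.-1, (foldl consume (q.2.2, [::]) (level q.2.1.-1 q.1)).2).

Lemma iter_ascend x j : j <= (m x).+1 ->
  iter j (fun p => ascend (x, p)) ((m x).+1, [::]) =
  ((m x).+1 - j, map f (level ((m x).+1 - j) x)).
Proof.
elim: j => [|j IH] lt_j; first by rewrite subn0 level_empty.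
rewrite iterS IH ?(ltnW lt_j) // /ascend /= -subnS.
have -> : level ((m x).+1 - j) x = calls (level ((m x).+1 - j.+1) x).
  by rewrite /level -iterS subnSK.
by have := foldl_consume (level ((m x).+1 - j.+1) x) [::] [::]; rewrite cats0 => ->.
Qed.

Lemma computable_recursion : computable f.
Proof.
pose up x := (iter (m x).+1 (fun p => ascend (x, p)) ((m x).+1, [::])).2.
(* Level 0 consists of [x] alone, so [up x] is the one-element list of [f x] and the second branch
   is never reached. *)
apply: (computable_ext (f := fun x => if up x is y :: s then y else G (x, [::]))).
  by move=> x; rewrite /up iter_ascend // subnn.
have clevel : computable (fun q : X * nat => level q.2 q.1).
  apply: (computable_iter (step := fun q => calls q.2)); computability.
  apply: computable_flatten; apply: (computable_map (F := fun q => D q.2)); computability.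
  by apply: (computable_comp (f := D)); computability.
have cconsume : computable
    (fun q : (X * (nat * seq Y)) * ((seq Y * seq Y) * X) => consume q.2.1 q.2.2).
  have cDq : computable (fun q : (X * (nat * seq Y)) * ((seq Y * seq Y) * X) => size (D q.2.2)).
    by apply: computable_size; apply: (computable_comp (f := D)); computability.
  apply: computable_pair; first by apply: computable_drop; computability.
  apply: computable_rcons; computability; apply: (computable_comp (f := G)); computability.
  by apply: computable_take; computability.
apply: (computable_case_seq (s := up) (c := fun q => q.2.1)); computability.
  apply: computable_snd; apply: (computable_iter (step := ascend)); computability.
  apply: computable_pair; computability.
  apply: (computable_foldl (step := fun q => consume q.2.1 q.2.2)) => //.
    by computability.
  apply: (computable_comp (f := fun q : X * nat => level q.2 q.1)
    (g := fun q : X * (nat * seq Y) => (q.1, q.2.1.-1))) => //; computability.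
by apply: (computable_comp (f := G)); computability.
Qed.

End Recursion.

(** * Computability of translations *)

Section FiniteCases.

(** Acts on a parameter paired with a tagged code and peels off one tag value: tag 0 goes to [g0],
    any other tag is lowered by one and passed to [g1]. Nesting gives the case distinction over the
    constructors of a type. *)
Definition tag_case (g0 g1 : nat -> nat) (n : nat) : nat :=
  if unpair1 (unpair2 n) is t.+1
  then g1 (pair_code (unpair1 n) (pair_code t (unpair2 (unpair2 n))))
  else g0 (pair_code (unpair1 n) (unpair2 (unpair2 n))).

Lemma tag_case0 g0 g1 x c :
  tag_case g0 g1 (pair_code x (pair_code 0 c)) = g0 (pair_code x c).
Proof. by rewrite /tag_case !unpair2_pair !unpair1_pair. Qed.

Lemma tag_caseS g0 g1 x t c :
  tag_case g0 g1 (pair_code x (pair_code t.+1 c)) = g1 (pair_code x (pair_code t c)).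
Proof. by rewrite /tag_case !unpair2_pair !unpair1_pair. Qed.

Lemma recursive_tag_case g0 g1 :
  recursive1 g0 -> recursive1 g1 -> recursive1 (tag_case g0 g1).
Proof.
move=> r0 r1.
have rt : recursive1 (fun n => unpair1 (unpair2 n)).
  exact: recursive1_comp recursive_unpair1 recursive_unpair2.
have rc : recursive1 (fun n => unpair2 (unpair2 n)).
  exact: recursive1_comp recursive_unpair2 recursive_unpair2.
apply: rec_ext (recursive_if rt (f := fun n => g1 (pair_code (unpair1 n)
    (pair_code (unpair1 (unpair2 n)).-1 (unpair2 (unpair2 n)))))
  (g := fun n => g0 (pair_code (unpair1 n) (unpair2 (unpair2 n)))) _ _) => [x||].
- by rewrite /tag_case; case: (unpair1 (unpair2 _)).
- apply: recursive1_comp r1 _; apply: recursive1_comp2 recursive_pair recursive_unpair1 _.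
  apply: recursive1_comp2 recursive_pair _ rc.
  exact: recursive1_comp recursive_pred rt.
- apply: recursive1_comp r0 _.
  exact: recursive1_comp2 recursive_pair recursive_unpair1 rc.
Qed.

(** The specification [P] is left abstract so that it may mention types depending on [t], such as
    tuples whose length is the arity of a symbol. It need not respect pointwise equality by itself,
    so the functions are identified by extensionality. *)
Lemma recursive_select (T : finType) (c : T -> nat) (P : T -> (nat -> nat) -> Prop) :
  injective c -> (forall t, exists2 g, recursive1 g & P t g) ->
  exists2 G, recursive1 G & forall t, P t (fun x => G (pair_code (c t) x)).
Proof.
move=> inj_c exg.
suff [G rG PG] : exists2 G, recursive1 G &
    forall t, t \in enum T -> P t (fun x => G (pair_code (c t) x)).
  by exists G => // t; apply: PG; rewrite mem_enum.
elim: (enum T) => [|t r [G rG PG]]; first by exists id => //; apply: recursive1_id.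
have [g rg Pg] := exg t.
(* The sum of the two truncated differences vanishes exactly when the codes are equal. *)
pose d n := (unpair1 n - c t) + (c t - unpair1 n).
have dE t' x : d (pair_code (c t') x) = (c t' - c t) + (c t - c t').
  by rewrite /d !unpair1_pair.
exists (fun n => if d n is 0 then g (unpair2 n) else G n).
  apply: recursive_if rG _; last exact: recursive1_comp rg recursive_unpair2.
  apply: recursive1_comp2 recursive_add _ _.
    exact: (recursive1_comp2 (h := fun=> c t)) recursive_sub recursive_unpair1 (recursive_cst _ _).
  exact: (recursive1_comp2 (g := fun=> c t)) recursive_sub (recursive_cst _ _) recursive_unpair1.
move=> t'; rewrite inE; case: (eqVneq t' t) => [->|ne_t] /=.
  move=> _; suff <- : g = fun x => if d (pair_code (c t) x) is 0
      then g (unpair2 (pair_code (c t) x)) else G (pair_code (c t) x) by [].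
  by apply: functional_extensionality => x; rewrite dE subnn unpair2_pair.
move/PG; suff <- : (fun x => G (pair_code (c t') x)) = fun x =>
    if d (pair_code (c t') x) is 0
    then g (unpair2 (pair_code (c t') x)) else G (pair_code (c t') x) by [].
apply: functional_extensionality => x; rewrite dE.
case E: (_ + _) => //; case/eqP: ne_t; apply: inj_c; lia.
Qed.

(** This makes the components of a translation computable: [tr_eq], [tr_rel] and [tr_fun] are
    arbitrary functions, but their indices range over finite types. *)
Lemma computable_select (T : finType) X Y `{Code T} `{Code X} `{Code Y}
    (h : T -> X -> Y) (t : X -> T) :
  injective (code : T -> nat) -> (forall t, computable (h t)) -> computable t ->
  computable (fun x => h (t x) x).
Proof.
move=> inj_T ch [k rk kE].
have [G rG GE] := recursive_select (P := fun t g => forall x, g (code x) = code (h t x)) inj_T ch.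
exists (fun n => G (pair_code (k n) n)).
  by apply: recursive1_comp rG _; apply: recursive1_comp2 recursive_pair rk recursive1_id.
by move=> x; rewrite kE GE.
Qed.

Lemma code_ord_inj n : injective (code : 'I_n -> nat).
Proof. exact: val_inj. Qed.

Lemma code_ffun_inj n A `{Code A} : injective (code : A -> nat) ->
  injective (code : {ffun 'I_n -> A} -> nat).
Proof. by move=> inj_A f g; apply: seq_code_ffun_inj => k y; apply: inj_A. Qed.

Lemma computable_finite n X Y `{Code X} `{Code Y} (h : 'I_n -> Y) (t : X -> 'I_n) :
  computable t -> computable (fun x => h (t x)).
Proof.
move=> ct; apply: (computable_select (h := fun i (_ : X) => h i)) ct.
  exact: code_ord_inj.
by move=> i; apply: computable_cst.
Qed.

Lemma computable_ffun n X A `{Code X} `{Code A} (F : X -> 'I_n -> A) :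
  (forall k, computable (fun x => F x k)) -> computable (fun x => [ffun k => F x k]).
Proof.
move=> cF; case: (computable_mkseq (F := fun k x => F x k) (enum 'I_n) cF) => g rg gE.
exists g => // x; rewrite gE /code /Code_seq /Code_ffun -map_comp.
by congr seq_code; apply: eq_map => k; rewrite /= ffunE.
Qed.

Lemma computable_ffun_app n X A `{Code X} `{Code A} (d : A) (f : X -> {ffun 'I_n -> A})
    (k : 'I_n) :
  computable f -> computable (fun x => f x k).
Proof.
move=> [g rg gE]; have cs : computable (fun x => [seq f x i | i <- enum 'I_n]).
  exists g => // x; rewrite gE /code /Code_seq /Code_ffun -map_comp.
  by [].
apply: (computable_ext (f := fun x => nth d [seq f x i | i <- enum 'I_n] k)).
  by move=> x; rewrite (nth_map k) ?size_enum_ord // nth_ord_enum.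
by apply: computable_nth => //; apply: computable_cst.
Qed.

End FiniteCases.

(** * Codes and case distinctions for formulas, atoms and terms *)

(** The clauses of [form_code], for any coded type of atoms, so that flat formulas receive codes as
    well. *)
Fixpoint fm_code At `{Code At} (A : fm At) : nat :=
  match A with
  | Bot => pair_code 0 0
  | Atom a => pair_code 1 (code a)
  | Imp A B => pair_code 2 (pair_code (fm_code A) (fm_code B))
  | All A => pair_code 3 (fm_code A)
  end.

#[global] Instance Code_fm At `{Code At} : Code (fm At) := @fm_code At _.
#[global] Instance Code_term S : Code (term S) := @term_code S.
#[global] Instance Code_atom S : Code (atom S) := @atom_code S.
#[global] Instance Code_flat_atom S : Code (flat_atom S) := fun a =>
  match a with
  | FEq x y => pair_code 0 (pair_code x y)
  | FRel r xs => pair_code 1 (pair_code (code r) (code xs))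
  | FFun f xs y => pair_code 2 (pair_code (code f) (pair_code (code xs) y))
  end.

Lemma form_codeE S (A : form S) : form_code A = code A.
Proof.
elim: A => //= [A IHA B IHB|A IH]; first by rewrite IHA IHB.
by rewrite IH.
Qed.

Section Formulas.
Context {X At Y : Type} `{Code X} `{Code At} `{Code Y}.

Lemma computable_Atom (a : X -> At) : computable a -> computable (fun x => Atom (a x)).
Proof.
case=> g rg gE; exists (fun x => pair_code 1 (g x)); last by move=> x; rewrite gE.
exact: (recursive1_comp2 (g := fun=> 1)) recursive_pair (recursive_cst _ 1) rg.
Qed.

Lemma computable_Imp (A B : X -> fm At) :
  computable A -> computable B -> computable (fun x => Imp (A x) (B x)).
Proof.
move=> [g rg gE] [h rh hE]; exists (fun x => pair_code 2 (pair_code (g x) (h x))).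
  apply: (recursive1_comp2 (g := fun=> 2)) recursive_pair (recursive_cst _ 2) _.
  exact: recursive1_comp2 recursive_pair rg rh.
by move=> x; rewrite gE hE.
Qed.

Lemma computable_All (A : X -> fm At) : computable A -> computable (fun x => All (A x)).
Proof.
case=> g rg gE; exists (fun x => pair_code 3 (g x)); last by move=> x; rewrite gE.
exact: (recursive1_comp2 (g := fun=> 3)) recursive_pair (recursive_cst _ 3) rg.
Qed.

Lemma computable_case_fm (A : X -> fm At) (hB : X -> Y) (hA : X * At -> Y)
    (hI : X * (fm At * fm At) -> Y) (hQ : X * fm At -> Y) :
  computable A -> computable hB -> computable hA -> computable hI -> computable hQ ->
  computable (fun x => match A x with
                       | Bot => hB x
                       | Atom a => hA (x, a)
                       | Imp B C => hI (x, (B, C))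
                       | All B => hQ (x, B)
                       end).
Proof.
move=> [g rg gE] [b rb bE] [a ra aE] [i ri iE] [q rq qE].
pose G := tag_case (fun n => b (unpair1 n)) (tag_case a (tag_case i
  (fun n => q (pair_code (unpair1 n) (unpair2 (unpair2 n)))))).
exists (fun x => G (pair_code x (g x))).
  apply: recursive1_comp; last exact: recursive1_comp2 recursive_pair recursive1_id rg.
  apply: recursive_tag_case; first exact: recursive1_comp rb recursive_unpair1.
  apply: recursive_tag_case ra _; apply: recursive_tag_case ri _.
  apply: recursive1_comp rq _; apply: recursive1_comp2 recursive_pair recursive_unpair1 _.
  exact: recursive1_comp recursive_unpair2 recursive_unpair2.
move=> x; rewrite gE /G; case: (A x) => [|c|B C|B].
- by rewrite tag_case0 unpair1_pair bE.
- by rewrite tag_caseS tag_case0 -aE.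
- by rewrite !tag_caseS tag_case0 -iE.
- by rewrite !tag_caseS !unpair2_pair unpair1_pair -qE.
Qed.

End Formulas.

Section Connectives.
Context {X At : Type} `{Code X} `{Code At}.
Implicit Types A B : X -> fm At.

Lemma computable_Neg A : computable A -> computable (fun x => Neg (A x)).
Proof. by move=> cA; apply: computable_Imp cA _; apply: computable_cst. Qed.

Lemma computable_And A B :
  computable A -> computable B -> computable (fun x => And (A x) (B x)).
Proof.
move=> cA cB; apply: computable_Neg; apply: computable_Imp cA _.
exact: computable_Neg.
Qed.

Lemma computable_Ex A : computable A -> computable (fun x => Ex (A x)).
Proof. by move=> cA; apply/computable_Neg/computable_All/computable_Neg. Qed.

Lemma computable_Exs n A : computable A -> computable (fun x => Exs n (A x)).
Proof. by move=> cA; elim: n => //= n; apply: computable_Ex. Qed.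

Lemma computable_Alls n A : computable A -> computable (fun x => Alls n (A x)).
Proof. by move=> cA; elim: n => //= n; apply: computable_All. Qed.

End Connectives.

Lemma computable_Conj X At `{Code X} `{Code At} (s : X -> seq (fm At)) :
  computable s -> computable (fun x => Conj (s x)).
Proof.
move=> cs; apply: (computable_foldr (step := fun q => And q.2.1 q.2.2)) => //.
  by apply: computable_And; computability.
exact: computable_cst.
Qed.

Section Terms.
Context {S : signature} {X Y : Type} `{Code X} `{Code Y}.

Lemma computable_Var (n : X -> nat) : computable n -> computable (fun x => Var (n x) : term S).
Proof.
case=> g rg gE; exists (fun x => pair_code 0 (g x)); last by move=> x; rewrite gE.
exact: (recursive1_comp2 (g := fun=> 0)) recursive_pair (recursive_cst _ 0) rg.
Qed.

Lemma computable_tagged (A B : Type) `{Code A} `{Code B} (F : A -> B) (t u : nat) (f : X -> A) :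
  (forall a, code (F a) = pair_code t (pair_code u (code a))) ->
  computable f -> computable (fun x => F (f x)).
Proof.
move=> FE [g rg gE]; exists (fun x => pair_code t (pair_code u (g x))).
  apply: (recursive1_comp2 (g := fun=> t)) recursive_pair (recursive_cst _ t) _.
  exact: (recursive1_comp2 (g := fun=> u)) recursive_pair (recursive_cst _ u) rg.
by move=> x; rewrite gE FE.
Qed.

Lemma computable_Fun (f : fsym S) (ts : X -> {ffun 'I_(far f) -> term S}) :
  computable ts -> computable (fun x => Fun f (ts x)).
Proof. exact: (computable_tagged (t := 1) (u := f)). Qed.

Lemma computable_ARel (r : rsym S) (ts : X -> {ffun 'I_(rar r) -> term S}) :
  computable ts -> computable (fun x => ARel r (ts x)).
Proof. exact: (computable_tagged (t := 1) (u := r)). Qed.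

Lemma computable_AEq (s t : X -> term S) :
  computable s -> computable t -> computable (fun x => AEq (s x) (t x)).
Proof.
move=> [g rg gE] [h rh hE]; exists (fun x => pair_code 0 (pair_code (g x) (h x))).
  apply: (recursive1_comp2 (g := fun=> 0)) recursive_pair (recursive_cst _ 0) _.
  exact: recursive1_comp2 recursive_pair rg rh.
by move=> x; rewrite gE hE.
Qed.

Lemma computable_FEq (a b : X -> nat) :
  computable a -> computable b -> computable (fun x => @FEq S (a x) (b x)).
Proof.
move=> [g rg gE] [h rh hE]; exists (fun x => pair_code 0 (pair_code (g x) (h x))).
  apply: (recursive1_comp2 (g := fun=> 0)) recursive_pair (recursive_cst _ 0) _.
  exact: recursive1_comp2 recursive_pair rg rh.
by move=> x; rewrite gE hE.
Qed.

Lemma computable_FRel (r : rsym S) (xs : X -> {ffun 'I_(rar r) -> nat}) :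
  computable xs -> computable (fun x => FRel r (xs x)).
Proof. exact: (computable_tagged (t := 1) (u := r)). Qed.

Lemma computable_FFun (f : fsym S) (xs : X -> {ffun 'I_(far f) -> nat}) (y : X -> nat) :
  computable xs -> computable y -> computable (fun x => FFun f (xs x) (y x)).
Proof.
move=> cxs cy; have cp : computable (fun x => (xs x, y x)) by apply: computable_pair.
exact: (computable_tagged (F := fun p => FFun f p.1 p.2) (t := 2) (u := f)) cp.
Qed.

(** The argument type of a branch depends on the symbol, so the branches are merged at the level of
    codes, where this dependency has disappeared. *)
Lemma recursive_case_symbol n (P : 'I_n -> (nat -> nat) -> Prop) :
  (forall i, exists2 g, recursive1 g & P i g) ->
  exists2 G, recursive1 G & forall i, exists2 g, P i g &
    forall x c, G (pair_code x (pair_code i c)) = g (pair_code x c).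
Proof.
move/(recursive_select val_inj) => [G rG PG].
exists (fun n => G (pair_code (unpair1 (unpair2 n)) (pair_code (unpair1 n) (unpair2 (unpair2 n))))).
  apply: recursive1_comp rG _; apply: recursive1_comp2 recursive_pair _ _.
    exact: recursive1_comp recursive_unpair1 recursive_unpair2.
  apply: recursive1_comp2 recursive_pair recursive_unpair1 _.
  exact: recursive1_comp recursive_unpair2 recursive_unpair2.
move=> i; exists (fun x => G (pair_code i x)); first exact: PG.
by move=> x c; rewrite !unpair2_pair !unpair1_pair.
Qed.

Lemma computable_case_term (t : X -> term S) (hV : X * nat -> Y)
    (hF : forall f : fsym S, X * {ffun 'I_(far f) -> term S} -> Y) :
  computable t -> computable hV -> (forall f, computable (@hF f)) ->
  computable (fun x => match t x with
                       | Var y => hV (x, y)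
                       | Fun f ts => hF f (x, ts)
                       end).
Proof.
move=> [g rg gE] [v rv vE] /recursive_case_symbol[w rw wE].
(* The branch [id] answers tags that no term carries. *)
exists (fun x => tag_case v (tag_case w id) (pair_code x (g x))).
  apply: recursive1_comp; last exact: recursive1_comp2 recursive_pair recursive1_id rg.
  apply: recursive_tag_case rv _; apply: recursive_tag_case rw recursive1_id.
move=> x; rewrite gE; case: (t x) => [y|f ts].
  by rewrite tag_case0 -vE.
have [h hE wf] := wE f.
by rewrite tag_caseS tag_case0 wf -hE.
Qed.

Lemma computable_case_atom (a : X -> atom S) (hE : X * (term S * term S) -> Y)
    (hR : forall r : rsym S, X * {ffun 'I_(rar r) -> term S} -> Y) :
  computable a -> computable hE -> (forall r, computable (@hR r)) ->
  computable (fun x => match a x with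
                       | AEq s t => hE (x, (s, t))
                       | ARel r ts => hR r (x, ts)
                       end).
Proof.
move=> [g rg gE] [v rv vE] /recursive_case_symbol[w rw wE].
exists (fun x => tag_case v (tag_case w id) (pair_code x (g x))).
  apply: recursive1_comp; last exact: recursive1_comp2 recursive_pair recursive1_id rg.
  apply: recursive_tag_case rv _; apply: recursive_tag_case rw recursive1_id.
move=> x; rewrite gE; case: (a x) => [s t|r ts].
  by rewrite tag_case0 -vE.
have [h hrE wr] := wE r.
by rewrite tag_caseS tag_case0 wr -hrE.
Qed.

Lemma computable_case_flat_atom (a : X -> flat_atom S) (hE : X * (nat * nat) -> Y)
    (hR : forall r : rsym S, X * {ffun 'I_(rar r) -> nat} -> Y)
    (hF : forall f : fsym S, X * ({ffun 'I_(far f) -> nat} * nat) -> Y) :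
  computable a -> computable hE -> (forall r, computable (@hR r)) ->
  (forall f, computable (@hF f)) ->
  computable (fun x => match a x with
                       | FEq y z => hE (x, (y, z))
                       | FRel r xs => hR r (x, xs)
                       | FFun f xs y => hF f (x, (xs, y))
                       end).
Proof.
move=> [g rg gE] [v rv vE] /recursive_case_symbol[w rw wE] /recursive_case_symbol[u ru uE].
exists (fun x => tag_case v (tag_case w (tag_case u id)) (pair_code x (g x))).
  apply: recursive1_comp; last exact: recursive1_comp2 recursive_pair recursive1_id rg.
  apply: recursive_tag_case rv _; apply: recursive_tag_case rw _.
  exact: recursive_tag_case ru recursive1_id.
move=> x; rewrite gE; case: (a x) => [y z|r xs|f xs y].
- by rewrite tag_case0 -vE.
- have [h hrE wr] := wE r.
  by rewrite tag_caseS tag_case0 wr -hrE.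
- have [h hfE uf] := uE f.
  by rewrite !tag_caseS tag_case0 uf -hfE.
Qed.

End Terms.

Section SubstitutionComputable.
Variable S : signature.

(** The term is fixed and only the renaming varies, as when a defining formula of a translation is
    instantiated; hence a plain induction on the term. *)
Lemma computable_ren_term X `{Code X} (s : X * nat -> nat) (t : term S) :
  computable s -> computable (fun x => subst_term (fun v => Var (s (x, v))) t).
Proof.
move=> cs; elim/term_ffun_ind: t => [v|f ts IH] /=.
  by apply: computable_Var; apply: (computable_comp (f := s)); computability.
exact/computable_Fun/computable_ffun.
Qed.

Lemma computable_ren X `{Code X} (s : X * nat -> nat) (A : form S) :
  computable s -> computable (fun x => subst (fun v => Var (s (x, v))) A).
Proof.
elim: A s => [|[t u|r ts]|A IHA B IHB|A IH] s cs /=.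
- exact: computable_cst.
- by apply: computable_Atom; apply: computable_AEq; apply: computable_ren_term.
- apply: computable_Atom; apply: computable_ARel; apply: computable_ffun => k.
  exact: computable_ren_term.
- by apply: computable_Imp; [apply: IHA|apply: IHB].
(* The renaming lifted under the binder, in the paired form that the induction hypothesis
   expects. *)
- apply: computable_All; pose s' q := if q.2 <= 0 then 0 else (s (q.1, q.2.-1)).+1.
  apply: (computable_ext (f := fun x => subst (fun v => Var (s' (x, v))) A)).
    by move=> x; congr subst; apply: functional_extensionality => - [].
  apply: IH; apply: computable_if; computability.
  by apply: (computable_comp (f := s)); computability.
Qed.

Lemma computable_inst X `{Code X} (A : form S) (xs : X -> seq nat) :
  computable xs -> computable (fun x => inst A (xs x)).
Proof.
move=> cxs; apply: (computable_ren A (s := fun q => nth 0 (xs q.1) q.2)).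
apply: computable_nth; computability.
by apply: (computable_comp (f := xs)); computability.
Qed.

End SubstitutionComputable.

Section FormulaCodes.
Context {At : Type} `{Code At}.
Implicit Types A B : fm At.

(** The tags of [Imp] and [All] are positive, so the code of a formula is a measure that decreases
    towards subformulas. *)
Lemma lt_pair_succ t n : n < pair_code t.+1 n.
Proof. by rewrite pair_codeE addnS /=; lia. Qed.

Lemma lt_code_Imp1 A B : (code A : nat) < code (Imp A B).
Proof. exact: leq_ltn_trans (leq_pair1 (code A) (code B)) (lt_pair_succ 1 _). Qed.

Lemma lt_code_Imp2 A B : (code B : nat) < code (Imp A B).
Proof. exact: leq_ltn_trans (leq_pair2 (code A) (code B)) (lt_pair_succ 1 _). Qed.

Lemma lt_code_All A : (code A : nat) < code (All A).
Proof. exact: lt_pair_succ. Qed.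

End FormulaCodes.

(** * Computability of unwinding *)

Section UnwindComputable.
Variable S : signature.

Lemma computable_is_var : computable (@is_var S).
Proof.
apply: (computable_case_term (t := id) (hV := fun=> true) (hF := fun _ _ => false)) => [||f];
  computability.
Qed.

Lemma computable_var_index : computable (@var_index S).
Proof.
apply: (computable_case_term (t := id) (hV := snd) (hF := fun _ _ => 0)) => [||f];
  computability.
Qed.

Lemma computable_all_var n X `{Code X} (ts : X -> {ffun 'I_n -> term S}) :
  computable ts -> computable (fun x => [forall k, is_var (ts x k)]).
Proof.
move=> cts; apply: (computable_ext (f := fun x =>
    all (@is_var S) [seq ts x k | k <- enum 'I_n])).
  move=> x; rewrite all_map; apply/allP/forallP => [h k|h k _]; last exact: h.
  by apply: h; rewrite mem_enum.
apply: computable_all; first exact: computable_is_var.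
apply: (computable_mkseq (F := fun k x => ts x k)) => k.
exact: (computable_ffun_app (Var 0) k cts).
Qed.

Lemma lt_code_seq s x : x \in s -> x < seq_code s.
Proof.
elim: s => //= y s IH; rewrite inE ltnS => /predU1P[->|/IH lt_x]; first exact: leq_pair1.
by apply: ltnW; apply: leq_trans lt_x _; apply: leq_pair2.
Qed.

Lemma lt_code_Fun (f : fsym S) (ts : {ffun 'I_(far f) -> term S}) k :
  (code (ts k) : nat) < code (Fun f ts).
Proof.
rewrite [code (Fun f ts)]/= ; apply: leq_trans (leq_pair2 _ _).
apply: leq_trans (leq_pair2 _ _); apply: lt_code_seq.
by apply: (map_f (fun k => term_code (ts k))); rewrite mem_enum.
Qed.

(** The offset and the value variable change from call to call, so they are part of the argument of
    the recursion. *)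
Let unwind_calls (q : (nat * nat) * term S) : seq ((nat * nat) * term S) :=
  match q.2 with
  | Var _ => [::]
  | Fun f ts => if [forall k, is_var (ts k)] then [::]
                else [seq ((far f + q.1.1, val k), ts k) | k <- enum 'I_(far f)]
  end.

Let unwind_step (p : ((nat * nat) * term S) * seq (fm (flat_atom S))) : fm (flat_atom S) :=
  match p.1.2 with
  | Var x => Atom (FEq (p.1.1.1 + x) p.1.1.2)
  | Fun f ts =>
      if [forall k, is_var (ts k)]
      then Atom (FFun f [ffun k => p.1.1.1 + var_index (ts k)] p.1.1.2)
      else Exs (far f) (And (Conj p.2) (Atom (FFun f [ffun k => val k] (far f + p.1.1.2))))
  end.

Lemma computable_unwind_term :
  computable (fun q : (nat * nat) * term S => unwind_term q.1.1 q.2 q.1.2).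
Proof.
apply: (computable_recursion (m := fun q => code q.2) (D := unwind_calls) (G := unwind_step)).
- by apply: computable_code; computability.
- apply: (computable_case_term (t := snd) (hV := fun=> [::])
    (hF := fun f p => if [forall k, is_var (p.2 k)] then [::]
       else [seq ((far f + p.1.1.1, val k), p.2 k) | k <- enum 'I_(far f)])); computability.
  move=> f; apply: computable_if; computability.
    by apply: computable_all_var; computability.
  apply: (computable_mkseq 
    (F := fun (k : 'I_(far f)) (p : ((nat * nat) * term S) * {ffun 'I_(far f) -> term S}) =>
       ((far f + p.1.1.1, val k), p.2 k)) (enum 'I_(far f))) => k; computability.
  by apply: (computable_ffun_app (Var 0)); computability.
- apply: (computable_case_term (t := fun p => p.1.2)
    (hV := fun p => Atom (FEq (p.1.1.1.1 + p.2) p.1.1.1.2))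
    (hF := fun f p => if [forall k, is_var (p.2 k)]
      then Atom (FFun f [ffun k => p.1.1.1.1 + var_index (p.2 k)] p.1.1.1.2)
      else Exs (far f) (And (Conj p.1.2)
             (Atom (FFun f [ffun k => val k] (far f + p.1.1.1.2)))))); computability.
    by apply: computable_Atom; apply: computable_FEq; computability.
  move=> f; apply: computable_if.
  + by apply: computable_all_var; computability.
  + apply: computable_Atom; apply: computable_FFun; computability.
    apply: computable_ffun => k; computability.
    apply: (computable_comp computable_var_index).
    by apply: (computable_ffun_app (Var 0)); computability.
  + apply: computable_Exs; apply: computable_And.
      by apply: computable_Conj; computability.
    by apply: computable_Atom; apply: computable_FFun; computability.
- move=> [[d y] [x|f ts]] q; rewrite /unwind_calls //=; case: ifP => //= _.
  by move=> /List.in_map_iff[k [<- _]]; apply: lt_code_Fun.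
- move=> [[d y] [x|f ts]] //=; rewrite /unwind_step /unwind_calls /=.
  by case: ifP => // _; rewrite -map_comp.
Qed.

Lemma computable_unwind_term_at X `{Code X} d y (t : X -> term S) :
  computable t -> computable (fun x => unwind_term d (t x) y).
Proof.
move=> ct; apply: (computable_comp computable_unwind_term (g := fun x => ((d, y), t x))).
by computability.
Qed.

Lemma computable_unwind_atom : computable (@unwind_atom S).
Proof.
pose hE (p : atom S * (term S * term S)) := match p.2.2 with
  | Var y => unwind_term 0 p.2.1 y
  | Fun f ts => Ex (And (unwind_term 1 (Fun f ts) 0) (unwind_term 1 p.2.1 0))
  end.
pose hR r (p : atom S * {ffun 'I_(rar r) -> term S}) :=
  if [forall k, is_var (p.2 k)]
  then Atom (FRel r [ffun k => var_index (p.2 k)])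
  else Exs (rar r) (And (Conj [seq unwind_term (rar r) (p.2 k) k | k <- enum 'I_(rar r)])
                        (Atom (FRel r [ffun k => val k]))).
apply: (computable_ext (f := fun a => match a with
    | AEq s t => hE (a, (s, t)) | ARel r ts => hR r (a, ts) end)).
  by move=> [s [y|f ts]|r ts].
apply: (computable_case_atom (a := id) (hE := hE) (hR := hR)).
- exact: computable_id.
- apply: (computable_case_term (t := fun p => p.2.2)
    (hV := fun q => unwind_term 0 q.1.2.1 q.2)
    (hF := fun f q => Ex (And (unwind_term 1 (Fun f q.2) 0) (unwind_term 1 q.1.2.1 0)))).
  + by computability.
  + apply: (computable_comp computable_unwind_term (g := fun q => ((0, q.2), q.1.2.1))).
    by computability.
  + move=> f; apply: computable_Ex; apply: computable_And; apply: computable_unwind_term_at; computability.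
    by apply: computable_Fun; computability.
- move=> r; apply: computable_if.
  + by apply: computable_all_var; computability.
  + apply: computable_Atom; apply: computable_FRel; apply: computable_ffun => k.
    apply: (computable_comp computable_var_index).
    by apply: (computable_ffun_app (Var 0)); computability.
  + apply: computable_Exs; apply: computable_And.
      apply: computable_Conj.
      apply: (computable_mkseq
        (F := fun k (p : atom S * {ffun 'I_(rar r) -> term S}) =>
                unwind_term (rar r) (p.2 k) k) (enum 'I_(rar r))) => k.
      by apply: computable_unwind_term_at; apply: (computable_ffun_app (Var 0)); computability.
    by apply: computable_Atom; apply: computable_FRel; computability.
Qed.

Lemma computable_unwind : computable (@unwind S).
Proof.
pose D (A : form S) := match A with
  | Imp B C => [:: B; C] | All B => [:: B] | _ => [::] end.
pose G (p : form S * seq (fm (flat_atom S))) := match p.1 with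
  | Bot => Bot
  | Atom a => unwind_atom a
  | Imp _ _ => Imp (nth Bot p.2 0) (nth Bot p.2 1)
  | All _ => All (nth Bot p.2 0)
  end.
apply: (computable_recursion (m := fun A => code A) (D := D) (G := G)).
- by apply: computable_code; computability.
- apply: (computable_case_fm (A := id) (hB := fun=> [::]) (hA := fun=> [::])
    (hI := fun p => [:: p.2.1; p.2.2]) (hQ := fun p => [:: p.2])); computability.
- apply: (computable_case_fm (A := fst) (hB := fun=> Bot) (hA := fun p => unwind_atom p.2)
    (hI := fun p => Imp (nth Bot p.1.2 0) (nth Bot p.1.2 1))
    (hQ := fun p => All (nth Bot p.1.2 0))); computability.
  + by apply: (computable_comp computable_unwind_atom); computability.
  + by apply: computable_Imp; apply: computable_nth; computability.
  + by apply: computable_All; apply: computable_nth; computability.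
- case=> [|a|A B|A] B' //=.
    by case=> [<-|[<-|//]]; [apply: lt_code_Imp1 | apply: lt_code_Imp2].
  by case=> [<-|//]; apply: lt_code_All.
- by case.
Qed.

End UnwindComputable.

(** * Computability of a fixed translation *)

Section TranslateComputable.
Variables (S T : signature) (K : translation S T).

Lemma computable_block X `{Code X} (e : X -> seq (piece K)) (x : X -> nat) :
  computable e -> computable x -> computable (fun q => block (e q) (x q)).
Proof.
move=> ce cx; apply: computable_iota.
  apply: computable_sumn; apply: (computable_map (F := fun p => tr_dim p.2)).
    by apply: computable_finite; computability.
  exact: computable_take.
by apply: computable_finite; apply: computable_nth.
Qed.

Lemma computable_piece_of X `{Code X} (e : X -> seq (piece K)) (x : X -> nat) :
  computable e -> computable x -> computable (fun q => piece_of (e q) (x q)).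
Proof. exact: computable_nth. Qed.

(** Once the pieces of the arguments are fixed by a finite selection, the translated atom is an
    instance of one fixed formula, with a computable list of variables. *)
Lemma computable_translate_atom :
  computable (fun q : seq (piece K) * flat_atom S => translate_atom q.1 q.2).
Proof.
pose Q := (seq (piece K) * flat_atom S)%type.
have cb n (A : Type) (CA : Code A) (e : A -> seq (piece K)) (xs : A -> {ffun 'I_n -> nat}) :
    computable e -> computable xs ->
    computable (fun q => flatten [seq block (e q) (xs q k) | k <- enum 'I_n]).
  move=> ce cxs; apply: computable_flatten.
  apply: (computable_mkseq (F := fun k q => block (e q) (xs q k)) (enum 'I_n)) => k.
  by apply: computable_block => //; apply: (computable_ffun_app 0).
have cp n (A : Type) (CA : Code A) (e : A -> seq (piece K)) (xs : A -> {ffun 'I_n -> nat}) :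
    computable e -> computable xs ->
    computable (fun q => [ffun k => piece_of (e q) (xs q k)]).
  move=> ce cxs; apply: computable_ffun => k.
  by apply: computable_piece_of => //; apply: (computable_ffun_app 0).
pose hE (p : Q * (nat * nat)) := translate_atom p.1.1 (@FEq S p.2.1 p.2.2).
pose hR r (p : Q * {ffun 'I_(rar r) -> nat}) := translate_atom p.1.1 (FRel r p.2).
pose hF f (p : Q * ({ffun 'I_(far f) -> nat} * nat)) := translate_atom p.1.1 (FFun f p.2.1 p.2.2).
apply: (computable_ext (f := fun q : Q => match q.2 with
    | FEq x y => hE (q, (x, y)) | FRel r xs => hR r (q, xs)
    | FFun f xs y => hF f (q, (xs, y)) end)).
  by case=> e [].
apply: (computable_case_flat_atom (a := snd) (hE := hE) (hR := hR) (hF := hF)) => [|||].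
- by computability.
- apply: (computable_select
    (h := fun i p => inst (tr_eq i (piece_of p.1.1 p.2.2))
                          (block p.1.1 p.2.1 ++ block p.1.1 p.2.2))
    (t := fun p => piece_of p.1.1 p.2.1)); first exact: code_ord_inj.
    move=> i; apply: (computable_select
      (h := fun j p => inst (tr_eq i j) (block p.1.1 p.2.1 ++ block p.1.1 p.2.2))
      (t := fun p => piece_of p.1.1 p.2.2)); first exact: code_ord_inj.
      move=> j; apply: computable_inst; apply: computable_cat;
        by apply: computable_block; computability.
    by apply: computable_piece_of; computability.
  by apply: computable_piece_of; computability.
- move=> r; pose t (p : Q * {ffun 'I_(rar r) -> nat}) := [ffun k => piece_of p.1.1 (p.2 k)].
  pose h (p' : {ffun 'I_(rar r) -> piece K}) (p : Q * {ffun 'I_(rar r) -> nat}) :=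
    inst (tr_rel p') (flatten [seq block p.1.1 (p.2 k) | k <- enum 'I_(rar r)]).
  (* The pieces of all arguments together form one element of a finite type, so a single selection
     suffices. *)
  rewrite -[hR r]/(fun p => h (t p) p); apply: computable_select.
  + exact/code_ffun_inj/code_ord_inj.
  + move=> p'; apply: computable_inst.
    by apply: (cb _ _ _ (fun p : Q * {ffun 'I_(rar r) -> nat} => p.1.1) (fun p => p.2)); computability.
  + by apply: (cp _ _ _ (fun p : Q * {ffun 'I_(rar r) -> nat} => p.1.1) (fun p => p.2)); computability.
- move=> f; pose P := (Q * ({ffun 'I_(far f) -> nat} * nat))%type.
  pose t (p : P) := [ffun k => piece_of p.1.1 (p.2.1 k)].
  pose xs (p : P) := flatten [seq block p.1.1 (p.2.1 k) | k <- enum 'I_(far f)] ++ block p.1.1 p.2.2.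
  have cxs : computable xs.
    apply: computable_cat; last by apply: computable_block; computability.
    by apply: (cb _ _ _ (fun p : P => p.1.1) (fun p => p.2.1)); computability.
  pose h i (p' : {ffun 'I_(far f) -> piece K}) (p : P) := inst (tr_fun p' i) (xs p).
  pose h' i (p : P) := h i (t p) p.
  rewrite -[hF f]/(fun p => h' (piece_of p.1.1 p.2.2) p).
  apply: computable_select; first exact: code_ord_inj.
    move=> i; apply: (computable_select (h := h i)).
    + exact/code_ffun_inj/code_ord_inj.
    + by move=> p'; apply: computable_inst.
    + by apply: (cp _ _ _ (fun p : P => p.1.1) (fun p => p.2.1)); computability.
  by apply: computable_piece_of; computability.
Qed.

Lemma computable_translate_flat :
  computable (fun q : seq (piece K) * fm (flat_atom S) => translate_flat q.1 q.2).
Proof.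
pose Q := (seq (piece K) * fm (flat_atom S))%type.
pose D (q : Q) : seq Q := match q.2 with
  | Imp A B => [:: (q.1, A); (q.1, B)]
  | All A => [seq (i :: q.1, A) | i <- enum 'I_(tr_pred_pieces K).+1]
  | _ => [::]
  end.
pose G (p : Q * seq (form T)) : form T := match p.1.2 with
  | Bot => Bot
  | Atom a => translate_atom p.1.1 a
  | Imp _ _ => Imp (nth Bot p.2 0) (nth Bot p.2 1)
  | All _ => Conj [seq Alls (tr_dim i) (Imp (tr_dom i) (nth Bot p.2 i))
                  | i : piece K <- enum 'I_(tr_pred_pieces K).+1]
  end.
(* The environment grows under quantifiers, but the measure looks at the formula alone. A quantifier
   makes one call per piece, in the order of the pieces, so [nth] at [i] retrieves the value for
   piece [i]. *)
apply: (computable_recursion (m := fun q => code q.2) (D := D) (G := G)).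
- by apply: computable_code; computability.
- apply: (computable_case_fm (A := snd) (hB := fun=> [::]) (hA := fun=> [::])
    (hI := fun p => [:: (p.1.1, p.2.1); (p.1.1, p.2.2)])
    (hQ := fun p => [seq (i :: p.1.1, p.2) | i <- enum 'I_(tr_pred_pieces K).+1])); computability.
  apply: (computable_mkseq (F := fun i (p : Q * fm (flat_atom S)) => (i :: p.1.1, p.2))
    (enum 'I_(tr_pred_pieces K).+1)) => i.
  by computability.
- pose hQ (p : (Q * seq (form T)) * fm (flat_atom S)) : form T :=
    Conj [seq Alls (tr_dim i) (Imp (tr_dom i) (nth Bot p.1.2 i))
         | i : piece K <- enum 'I_(tr_pred_pieces K).+1].
  apply: (computable_case_fm (A := fun p => p.1.2) (hB := fun=> Bot)
    (hA := fun p => translate_atom p.1.1.1 p.2)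
    (hI := fun p => Imp (nth Bot p.1.2 0) (nth Bot p.1.2 1)) (hQ := hQ)); computability.
  + apply: (computable_comp computable_translate_atom
      (g := fun p : (Q * seq (form T)) * flat_atom S => (p.1.1.1, p.2))).
    by computability.
  + by apply: computable_Imp; apply: computable_nth; computability.
  + apply: computable_Conj; apply: (computable_mkseq
      (F := fun (i : piece K) (p : (Q * seq (form T)) * fm (flat_atom S)) =>
         Alls (tr_dim i) (Imp (tr_dom i) (nth Bot p.1.2 i)))
      (enum 'I_(tr_pred_pieces K).+1)) => i.
    apply: computable_Alls; apply: computable_Imp; first by computability.
    by apply: computable_nth; computability.
- move=> [e [|a|A B|A]] q //=.
    by case=> [<-|[<-|//]] /=; [apply: lt_code_Imp1 | apply: lt_code_Imp2].
  by move/List.in_map_iff=> [i [<- _]]; apply: lt_code_All.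
- move=> [e [|a|A B|A]] //=; rewrite /G /D /=; congr Conj.
  apply: eq_map => i; congr (Alls _ (Imp _ _)).
  by rewrite -map_comp (nth_map i) ?size_enum_ord // nth_ord_enum.
Qed.

Lemma computable_translate : computable (@translate S T K).
Proof.
apply: (computable_comp computable_translate_flat (g := fun A => ([::], unwind A))).
apply: computable_pair; [exact: computable_cst | exact: computable_unwind].
Qed.

End TranslateComputable.

Theorem theorem4p3 (U V : theory) :
  retract V U ->
  (friedman_reflexive U -> friedman_reflexive V) /\
  (effectively_friedman_reflexive U -> effectively_friedman_reflexive V).
Proof.
move=> [K [M KM]]; split=> [reflU A|[f rf fE]].
  have [C intC] := reflU A; exists (sentence_translate M C).
  exact: interpreter_translate KM intC.
have [g rg gE] := computable_translate M.
exists (fun n => g (f n)); first exact: recursive1_comp.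
move=> A; have [C intC fC] := fE A; exists (sentence_translate M C).
  exact: interpreter_translate KM intC.
by rewrite fC /sentence_code !form_codeE gE.
Qed.
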